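(* Let $E$ be a directed graph with no sinks or sources, let $(E,\mathcal{L})$ be a labeled graph over a finite alphabet $\mathcal{A}$ such that $(E,\mathcal{L},\mathcal{E})$ is weakly left-resolving, let $(\mathbb{E}^0,\mathbb{E}^1,d,r)$ be the topological graph of $(E,\mathcal{L})$, and suppose $d:\mathbb{E}^1\to\mathbb{E}^0$ is injective. Then $C^*(E,\mathcal{L})$ is isomorphic to the crossed product $C\big(\overline{\mathcal{L}(E^{\infty}_{-\infty})}\big)\times_\tau\mathbb{Z}$, where $\tau$ is the shift homeomorphism of $\overline{\mathcal{L}(E^{\infty}_{-\infty})}$.
   Context: A directed graph $E=(E^0,E^1,r,s)$ consists of vertices $E^0$, edges $E^1$ and range and source maps $r,s:E^1\to E^0$. It has no sinks or sources if $s$ and $r$ are both surjective. $E^n$ is the set of paths $\lambda=\lambda_1\cdots\lambda_n$ of length $n$ (with $r(\lambda_i)=s(\lambda_{i+1})$), and $E^{\ge 1}=\bigcup_{n\ge1}E^n$; put $s(\lambda)=s(\lambda_1)$, $r(\lambda)=r(\lambda_n)$. A labeled graph $(E,\mathcal{L})$ over an alphabet $\mathcal{A}$ is a directed graph with a surjective labeling map $\mathcal{L}:E^1\to\mathcal{A}$, extended letterwise to finite and infinite paths. Put $\mathcal{L}^*(E)=\mathcal{L}(E^{\geq 1})$. For $\alpha\in\mathcal{L}^*(E)$ and $A\subset E^0$, $r(\alpha)=\{r(\lambda):\lambda\in E^{\ge1},\ \mathcal{L}(\lambda)=\alpha\}$ and $r(A,\alpha)=\{r(\lambda):\lambda\in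 E^{\ge 1},\ s(\lambda)\in A,\ \mathcal{L}(\lambda)=\alpha\}$. $\mathcal{E}$ denotes the smallest collection of subsets of $E^0$ that contains $r(\alpha)$ for all $\alpha\in\mathcal{L}^*(E)$ and is closed under finite unions, finite intersections, relative complements, and $A\mapsto r(A,\alpha)$ for all $\alpha\in\mathcal{L}^*(E)$. $(E,\mathcal{L},\mathcal{E})$ is weakly left-resolving if $r(A,\alpha)\cap r(B,\alpha)=r(A\cap B,\alpha)$ for all $A,B\in\mathcal{E}$, $\alpha\in\mathcal{L}^*(E)$. $E^\infty_{-\infty}$ is the set of bi-infinite paths $\cdots\lambda_{-1}\lambda_0\lambda_1\cdots$ with $\lambda_i\in E^1$, $r(\lambda_i)=s(\lambda_{i+1})$ for all $i\in\mathbb{Z}$, and $\overline{\mathcal{L}(E^\infty_{-\infty})}$ is the closure of $\mathcal{L}(E^\infty_{-\infty})$ in the compact product space $\mathcal{A}^{\mathbb{Z}}$. The shift is $\tau(\mathbf{a})(i)=\mathbf{a}(i+1)$, $i\in\mathbb{Z}$; it restricts to a homeomorphism of $\overline{\mathcal{L}(E^\infty_{-\infty})}$. $C^*(E,\mathcal{L})=C^*(E,\mathcal{L},\mathcal{E})$ is the universal $C^*$-algebra generated by projections $\{p_A: A\in\mathcal{E}\}$ and partial isometries $\{s_a:a\in\mathcal{A}\}$ such that for $A,B\in\mathcal{E}$, $a,b\in\mathcal{A}$: (i) $p_\emptyset=0$, $p_{A\cap B}=p_Ap_B$, $p_{A\cup B}=p_A+p_B-p_{A\cap B}$; (ii) $p_As_a=s_ap_{r(A,a)}$;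 (iii) $s_a^*s_a=p_{r(a)}$, and $s_a^*s_b=0$ unless $a=b$; (iv) $p_A=\sum_{a\in\mathcal{L}(AE^1)}s_ap_{r(A,a)}s_a^*$, where $AE^1=\{e\in E^1:s(e)\in A\}$. Topological graph of $(E,\mathcal{L})$: $\widehat{\mathcal{E}}$ is the set of ultrafilters of the Boolean algebra $\mathcal{E}$, with the topology having basis $Z(A)=\{\xi\in\widehat{\mathcal{E}}:A\in\xi\}$, $A\in\mathcal{E}$. For $a\in\mathcal{A}$ let $\mathcal{I}_a=\{B\in\mathcal{E}:B\subset r(a)\}$, a Boolean algebra with ultrafilter space $\widehat{\mathcal{I}}_a$ (topologized in the same way), and for $\xi\in\widehat{\mathcal{I}}_a$ let $\iota(\xi)=\{A\in\mathcal{E}:A\supset B\text{ for some }B\in\xi\}\in\widehat{\mathcal{E}}$ and $\widehat{\theta}_a(\xi)=\{A\in\mathcal{E}:r(A,a)\in\xi\}\in\widehat{\mathcal{E}}$. Then $\mathbb{E}^0=\widehat{\mathcal{E}}$, $\mathbb{E}^1=\bigsqcup_{a\in\mathcal{A}}\widehat{\mathcal{I}}_a$ (disjoint union), the element of $\mathbb{E}^1$ given by $\xi\in\widehat{\mathcal{I}}_a$ is written $e^a_\xi$, and $d,r:\mathbb{E}^1\to\mathbb{E}^0$ are $d(e^a_\xi)=\iota(\xi)$, $r(e^a_\xi)=\widehat{\theta}_a(\xi)$. *)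

(* Defs.v *)
From HB Require Import structures.
From mathcomp Require Import all_boot all_order all_algebra.
From mathcomp Require Import all_classical all_reals all_analysis.
From mathcomp Require Import complex.

Set Implicit Arguments.
Unset Strict Implicit.
Unset Printing Implicit Defensive.

Import Order.TTheory GRing.Theory Num.Theory.
Import numFieldNormedType.Exports.

Local Open Scope classical_set_scope.
Local Open Scope ring_scope.

(* No unit is required: C*-algebras, and homomorphisms between them, need not
   be unital.  The ring structures of MathComp all have a unit, hence the
   separate multiplication [smul]. *)
HB.mixin Record Lmodule_isStarAlgebra (R : realType) V
    & GRing.Lmodule R[i] V := {
  smul : V -> V -> V;
  star : V -> V;
  smulA : forall x y z, smul x (smul y z) = smul (smul x y) z;
  smulDl : forall x y z, smul (x + y) z = smul x z + smul y z;
  smulDr : forall x y z, smul x (y + z) = smul x y + smul x z;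
  smulZl : forall (k : R[i]) x y, smul (k *: x) y = k *: smul x y;
  smulZr : forall (k : R[i]) x y, smul x (k *: y) = k *: smul x y;
  starK : forall x, star (star x) = x;
  starD : forall x y, star (x + y) = star x + star y;
  starZ : forall (k : R[i]) x, star (k *: x) = Num.conj k *: star x;
  starM : forall x y, star (smul x y) = smul (star y) (star x)
}.

#[short(type="starAlgType")]
HB.structure Definition StarAlgebra (R : realType) :=
  {V of GRing.Lmodule R[i] V & Lmodule_isStarAlgebra R V}.

Infix "**" := smul (at level 40, left associativity) : ring_scope.

(* The norm takes values in the nonnegative reals of R[i]. *)
HB.mixin Record StarAlgebra_isCStar (R : realType) V
    & CompleteNormedModule R[i] V & Lmodule_isStarAlgebra R V := {
  smul_norm : forall x y : V, `|x ** y| <= `|x| * `|y|;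
  cstar_norm : forall x : V, `|star x ** x| = `|x| ^+ 2
}.

#[short(type="cstarAlgType")]
HB.structure Definition CStarAlgebra (R : realType) :=
  {V of CompleteNormedModule R[i] V & Lmodule_isStarAlgebra R V
      & StarAlgebra_isCStar R V}.

Definition star_hom (R : realType) (A B : starAlgType R) (phi : A -> B) : Prop :=
  [/\ linear phi,
      forall x y, phi (x ** y) = phi x ** phi y
    & forall x, phi (star x) = star (phi x)].

Definition cstar_isomorphic (R : realType) (A B : cstarAlgType R) : Prop :=
  exists phi : A -> B, star_hom phi /\ bijective phi.

Definition projection (R : realType) (A : starAlgType R) (x : A) : Prop :=
  star x = x /\ x ** x = x.

Definition partial_isometry (R : realType) (A : starAlgType R) (x : A) : Prop :=
  x ** star x ** x = x.

Definition is_identity (R : realType) (A : starAlgType R) (e : A) : Prop :=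
  forall x, e ** x = x /\ x ** e = x.

Definition closed_star_subalgebra (R : realType) (A : cstarAlgType R)
    (S : set A) : Prop :=
  [/\ closed S, S 0,
      forall (k : R[i]) x y, S x -> S y -> S (k *: x + y),
      forall x y, S x -> S y -> S (x ** y)
    & forall x, S x -> S (star x)].

Definition generates (R : realType) (A : cstarAlgType R) (G : set A) : Prop :=
  forall S : set A, closed_star_subalgebra S -> G `<=` S -> S = setT.

Definition Cfun (R : realType) (X : topologicalType) : Type :=
  continuousType X R[i]^o.

HB.instance Definition _ (R : realType) (X : topologicalType) :=
  Choice.on (Cfun R X).

Section Cfun_theory.
Variables (R : realType) (X : topologicalType).
Implicit Types (f g h : Cfun R X) (k : R[i]).

Let mkC (f : X -> R[i]^o) (cf : continuous f) : Cfun R X := mkcts cf.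

Lemma Cfun_eqP f g : f =1 g -> f = g.
Proof. by move/continuousEP. Qed.

Lemma Cfun_add_continuous f g : continuous (fun x => f x + g x : R[i]^o).
Proof. by move=> x; apply: cvgD; exact: cts_fun. Qed.

Lemma Cfun_opp_continuous f : continuous (fun x => - f x : R[i]^o).
Proof. by move=> x; apply: cvgN; exact: cts_fun. Qed.

Lemma Cfun_scale_continuous k f : continuous (fun x => k *: f x : R[i]^o).
Proof. by move=> x; apply: cvgZ; [exact: cvg_cst | exact: cts_fun]. Qed.

Lemma Cfun_mul_continuous f g : continuous (fun x => f x * g x : R[i]^o).
Proof.
by move=> x; apply: (@cvgZ _ R[i]^o); exact: cts_fun.
Qed.

Lemma Cfun_conj_continuous f :
  continuous (fun x => Num.conj (f x : R[i]) : R[i]^o).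
Proof.
move=> x; apply/cvgrPdist_lt => e e0.
have /cvgrPdist_lt/(_ e e0) := @cts_fun _ _ f x.
by apply: filterS => y; rewrite -rmorphB norm_conjC.
Qed.

Definition Cfun0 : Cfun R X := cst (0 : R[i]^o).
Definition Cfun1 : Cfun R X := cst (1 : R[i]^o).
Definition Cfun_add f g : Cfun R X := mkC (@Cfun_add_continuous f g).
Definition Cfun_opp f : Cfun R X := mkC (@Cfun_opp_continuous f).
Definition Cfun_scale k f : Cfun R X := mkC (@Cfun_scale_continuous k f).
Definition Cfun_mul f g : Cfun R X := mkC (@Cfun_mul_continuous f g).
Definition Cfun_conj f : Cfun R X := mkC (@Cfun_conj_continuous f).

Lemma Cfun_addA : associative Cfun_add.
Proof. by move=> f g h; apply: Cfun_eqP => x; exact: addrA. Qed.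
Lemma Cfun_addC : commutative Cfun_add.
Proof. by move=> f g; apply: Cfun_eqP => x; exact: addrC. Qed.
Lemma Cfun_add0 : left_id Cfun0 Cfun_add.
Proof. by move=> f; apply: Cfun_eqP => x; exact: add0r. Qed.
Lemma Cfun_addN : left_inverse Cfun0 Cfun_opp Cfun_add.
Proof. by move=> f; apply: Cfun_eqP => x; exact: addNr. Qed.

HB.instance Definition _ := GRing.isZmodule.Build (Cfun R X)
  Cfun_addA Cfun_addC Cfun_add0 Cfun_addN.

Lemma Cfun_scaleA k l f : Cfun_scale k (Cfun_scale l f) = Cfun_scale (k * l) f.
Proof. by apply: Cfun_eqP => x; exact: scalerA. Qed.
Lemma Cfun_scale1 : left_id 1 Cfun_scale.
Proof. by move=> f; apply: Cfun_eqP => x; exact: scale1r. Qed.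
Lemma Cfun_scaleDr : right_distributive Cfun_scale +%R.
Proof. by move=> k f g; apply: Cfun_eqP => x; exact: scalerDr. Qed.
Lemma Cfun_scaleDl f : {morph Cfun_scale^~ f : k l / k + l}.
Proof. by move=> k l; apply: Cfun_eqP => x; exact: scalerDl. Qed.

HB.instance Definition _ := GRing.Zmodule_isLmodule.Build R[i] (Cfun R X)
  Cfun_scaleA Cfun_scale1 Cfun_scaleDr Cfun_scaleDl.

Lemma Cfun_mulA f g h : Cfun_mul f (Cfun_mul g h) = Cfun_mul (Cfun_mul f g) h.
Proof. by apply: Cfun_eqP => x; exact: mulrA. Qed.
Lemma Cfun_mulDl f g h : Cfun_mul (f + g) h = Cfun_mul f h + Cfun_mul g h.
Proof. by apply: Cfun_eqP => x; exact: mulrDl. Qed.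
Lemma Cfun_mulDr f g h : Cfun_mul f (g + h) = Cfun_mul f g + Cfun_mul f h.
Proof. by apply: Cfun_eqP => x; exact: mulrDr. Qed.
Lemma Cfun_mulZl k f g : Cfun_mul (k *: f) g = k *: Cfun_mul f g.
Proof. by apply: Cfun_eqP => x; apply/esym; exact: mulrA. Qed.
Lemma Cfun_mulZr k f g : Cfun_mul f (k *: g) = k *: Cfun_mul f g.
Proof. by apply: Cfun_eqP => x; exact: mulrCA. Qed.
Lemma Cfun_conjK f : Cfun_conj (Cfun_conj f) = f.
Proof. by apply: Cfun_eqP => x; exact: conjCK. Qed.
Lemma Cfun_conjD f g : Cfun_conj (f + g) = Cfun_conj f + Cfun_conj g.
Proof. by apply: Cfun_eqP => x; exact: (rmorphD Num.conj). Qed.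
Lemma Cfun_conjZ k f : Cfun_conj (k *: f) = Num.conj k *: Cfun_conj f.
Proof. by apply: Cfun_eqP => x; exact: (rmorphM Num.conj). Qed.
Lemma Cfun_conjM f g : Cfun_conj (Cfun_mul f g) = Cfun_mul (Cfun_conj g) (Cfun_conj f).
Proof.
apply: Cfun_eqP => x; rewrite /= /mkcts mulrC; exact: (rmorphM Num.conj).
Qed.

HB.instance Definition _ := Lmodule_isStarAlgebra.Build R (Cfun R X)
  Cfun_mulA Cfun_mulDl Cfun_mulDr Cfun_mulZl Cfun_mulZr
  Cfun_conjK Cfun_conjD Cfun_conjZ Cfun_conjM.

End Cfun_theory.

Record homeomorphism (X : topologicalType) := Homeomorphism {
  homeo_fun : continuousType X X;
  homeo_inv : continuousType X X;
  homeo_funK : cancel homeo_fun homeo_inv;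
  homeo_invK : cancel homeo_inv homeo_fun
}.

(* A covariant representation in D of the dynamical system (C(X), Z) whose
   generating automorphism is f |-> f \o h^-1: a unital homomorphism pi and a
   unitary u of D (which must be unital, with identity pi 1). *)
Definition covariant_rep (R : realType) (X : topologicalType)
    (h : homeomorphism X) (D : cstarAlgType R) (pi : Cfun R X -> D) (u : D) : Prop :=
  [/\ star_hom pi,
      is_identity (pi (Cfun1 R X)),
      star u ** u = pi (Cfun1 R X) /\ u ** star u = pi (Cfun1 R X)
    & forall f : Cfun R X, u ** pi f ** star u = pi (f \o homeo_inv h : Cfun R X)].

(* The full crossed product, through its universal property; as Z is amenable it
   is also the reduced one. *)
Definition is_crossed_product (R : realType) (X : topologicalType)
    (h : homeomorphism X) (D : cstarAlgType R) (pi : Cfun R X -> D) (u : D) : Prop :=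
  [/\ covariant_rep h pi u,
      generates (range pi `|` [set u])
    & forall (B : cstarAlgType R) (rho : Cfun R X -> B) (v : B),
        covariant_rep h rho v ->
        exists phi : D -> B,
          [/\ star_hom phi, forall f, phi (pi f) = rho f & phi u = v]].

Record digraph := Digraph {
  vertex : Type;
  edge : Type;
  esrc : edge -> vertex;
  erng : edge -> vertex
}.

Definition no_sinks (E : digraph) : Prop := forall v, exists e, @esrc E e = v.
Definition no_sources (E : digraph) : Prop := forall v, exists e, @erng E e = v.

Record labeledGraph (A : Type) := LabeledGraph {
  graph :> digraph;
  label : edge graph -> A;
  label_surj : forall a, exists e, label e = a
}.

Section LabeledGraph.
Variables (A : Type) (E : labeledGraph A).
Local Notation V := (vertex E).

(* A path of length >= 1 is given by its first edge [e] and the sequence [q] of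
   the remaining ones. *)
Fixpoint is_path (e : edge E) (q : seq (edge E)) : Prop :=
  if q is f :: q' then erng e = esrc f /\ is_path f q' else True.

Definition lwords : set (seq A) :=
  [set al | exists e q, is_path e q /\ map (@label A E) (e :: q) = al].

Definition rword (al : seq A) : set V :=
  [set v | exists e q,
     [/\ is_path e q, map (@label A E) (e :: q) = al & erng (last e q) = v]].

Definition rrel (U : set V) (al : seq A) : set V :=
  [set v | exists e q,
     [/\ is_path e q, U (esrc e), map (@label A E) (e :: q) = al
       & erng (last e q) = v]].

Inductive accommodating : set (set V) :=
| acc_rword al : lwords al -> accommodating (rword al)
| acc_setU U W : accommodating U -> accommodating W -> accommodating (U `|` W)
| acc_setI U W : accommodating U -> accommodating W -> accommodating (U `&` W)
| acc_setD U W : accommodating U -> accommodating W -> accommodating (U `\` W)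
| acc_rrel U al : accommodating U -> lwords al -> accommodating (rrel U al).

Definition weakly_left_resolving : Prop :=
  forall U W al, accommodating U -> accommodating W -> lwords al ->
    rrel U al `&` rrel W al = rrel (U `&` W) al.

(* L(U E^1) *)
Definition out_labels (U : set V) : set A :=
  [set a | exists e : edge E, U (esrc e) /\ label e = a].

End LabeledGraph.

Arguments lwords {A} E.
Arguments rword {A} E al.
Arguments accommodating {A} E U.
Arguments weakly_left_resolving {A} E.

(* The projections are indexed by all sets of vertices for convenience, but only
   the values of [p] on [accommodating E] are relevant. *)
Record labeled_graph_rep (R : realType) (A : finType) (E : labeledGraph A)
    (B : cstarAlgType R) (p : set (vertex E) -> B) (s : A -> B) : Prop := {
  lgr_proj : forall U, accommodating E U -> projection (p U);
  lgr_piso : forall a, partial_isometry (s a);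
  lgr_set0 : p set0 = 0;
  lgr_setI : forall U W, accommodating E U -> accommodating E W ->
    p (U `&` W) = p U ** p W;
  lgr_setU : forall U W, accommodating E U -> accommodating E W ->
    p (U `|` W) = p U + p W - p (U `&` W);
  lgr_comm : forall U a, accommodating E U ->
    p U ** s a = s a ** p (rrel U [:: a]);
  lgr_starM : forall a, star (s a) ** s a = p (rword E [:: a]);
  lgr_ortho : forall a b, a <> b -> star (s a) ** s b = 0;
  lgr_sum : forall U, accommodating E U ->
    p U = \sum_(a : A | a \in out_labels U)
            s a ** p (rrel U [:: a]) ** star (s a)
}.

Definition is_labeled_graph_algebra (R : realType) (A : finType)
    (E : labeledGraph A) (B : cstarAlgType R)
    (p : set (vertex E) -> B) (s : A -> B) : Prop :=
  [/\ labeled_graph_rep p s,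
      generates (p @` accommodating E `|` range s)
    & forall (D : cstarAlgType R) (q : set (vertex E) -> D) (t : A -> D),
        labeled_graph_rep q t ->
        exists phi : B -> D,
          [/\ star_hom phi, forall U, accommodating E U -> phi (p U) = q U
            & forall a, phi (s a) = t a]].

Section Ultrafilters.
Variables (V : Type) (Q : set (set V)).

Definition proper_filter (xi : set (set V)) : Prop :=
  [/\ xi `<=` Q, xi !=set0, ~ xi set0,
      forall U W, xi U -> xi W -> xi (U `&` W)
    & forall U W, xi U -> Q W -> U `<=` W -> xi W].

Definition ultra_filter : set (set (set V)) :=
  [set xi | proper_filter xi /\
     forall eta, proper_filter eta -> xi `<=` eta -> eta = xi].

End Ultrafilters.

Section TopologicalGraph.
Variables (A : Type) (E : labeledGraph A).
Local Notation V := (vertex E).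

(* Of the topological graph, only the sets of vertices and edges and the map d
   are needed to speak of the injectivity of d. *)
Definition tg_vertex : Type := set_type (ultra_filter (accommodating E)).

Definition ideal_letter (a : A) : set (set V) :=
  [set U | accommodating E U /\ U `<=` rword E [:: a]].

Definition tg_edge : Type := {a : A & set_type (ultra_filter (ideal_letter a))}.

Definition iota (xi : set (set V)) : set (set V) :=
  [set U | accommodating E U /\ exists W, xi W /\ W `<=` U].

Lemma iota_ultra_filter a xi :
  ultra_filter (ideal_letter a) xi -> ultra_filter (accommodating E) (iota xi).
Proof.
move=> [[sub [W0 W0xi] x0 xI xS] xmax]; split.
  split.
  - by move=> U [].
  - by exists W0; split; [have [] := sub _ W0xi | exists W0; split].
  - move=> [_ [W [xW]]]; rewrite subset0 => W0e.
    by apply: x0; rewrite -W0e.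
  - move=> U1 U2 [a1 [W1 [xW1 s1]]] [a2 [W2 [xW2 s2]]]; split.
      exact: acc_setI.
    exists (W1 `&` W2); split; first exact: xI.
    by move=> v [/s1 ? /s2 ?].
  - move=> U W [aU [W1 [xW1 s1]]] aW UW; split=> //.
    by exists W1; split => //; exact: subset_trans UW.
move=> eta [esub _ e0 eI eS] ieta; apply/seteqP; split => // U eU; split.
  exact: esub.
have xeta W : xi W -> eta W.
  by move=> xW; apply: ieta; split; [have [] := sub _ xW | exists W; split].
have <- : eta `&` ideal_letter a = xi.
  apply: xmax; last by move=> W xW; split; [exact: xeta | exact: sub].
  split.
  - by move=> W [].
  - by exists W0; split; [exact: xeta | exact: sub].
  - by case.
  - move=> U1 U2 [e1 [a1 s1]] [e2 [a2 s2]]; split; first exact: eI.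
    by split; [exact: acc_setI | move=> v [/s1]].
  - by move=> U1 U2 [e1 [a1 s1]] i2 U12; split => //; apply: eS U12 => //; exact: i2.1.
exists (U `&` W0); split; last by move=> v [].
split; first by apply: eI => //; exact: xeta.
have [aW0 sW0] := sub _ W0xi.
by split; [apply: acc_setI => //; exact: esub | move=> v [_ /sW0]].
Qed.

Definition tg_d (e : tg_edge) : tg_vertex :=
  SigSub (mem_set (iota_ultra_filter (set_valP (tagged e)))).

End TopologicalGraph.

Lemma reindex_continuous (I J : eqType) (T : topologicalType) (k : I -> J) :
  continuous ((fun x i => x (k i)) :
    prod_topology (fun _ : J => T) -> prod_topology (fun _ : I => T)).
Proof.
move=> x; apply/cvg_sup.
  exact/fmap_filter/(nbhs_filter (x : prod_topology (fun _ : J => T))).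
move=> i; move: x.
apply/(@continuousP _ (initial_topology (fun f : I -> T => f i))) => U [B oB <-].
rewrite -[X in open X]/((fun x : prod_topology (fun _ : J => T) => x (k i)) @^-1` B).
apply: open_comp => //= x _; exact: (@proj_continuous _ (fun _ : J => T) (k i) x).
Qed.

Section ShiftSpace.
Variables (A : finType) (E : labeledGraph A).

Definition biseq : topologicalType :=
  prod_topology (fun _ : int => discrete_topology A).

Definition shift (x : biseq) : biseq := fun i => x (i + 1).
Definition unshift (x : biseq) : biseq := fun i => x (i - 1).

(* L(E^oo_-oo) *)
Definition label_seqs : set biseq :=
  [set x | exists la : int -> edge E,
     (forall i, erng (la i) = esrc (la (i + 1))) /\
     (forall i, x i = label (la i))].

Definition shift_space : set biseq := closure label_seqs.

Lemma shiftK : cancel shift unshift.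
Proof. by move=> x; apply/funext => i; rewrite /shift /unshift subrK. Qed.

Lemma unshiftK : cancel unshift shift.
Proof. by move=> x; apply/funext => i; rewrite /shift /unshift addrK. Qed.

Lemma closure_stable (f : biseq -> biseq) : continuous f ->
  (forall x, label_seqs x -> label_seqs (f x)) ->
  forall x, shift_space x -> shift_space (f x).
Proof.
move=> cf lf x cx U /cf /cx [y [ly Uy]]; exists (f y); split => //; exact: lf.
Qed.

Lemma shift_stable x : shift_space x -> shift_space (shift x).
Proof.
apply: closure_stable; first exact: (@reindex_continuous int int).
move=> {}x [la [pla xla]]; exists (fun i => la (i + 1)).
by split=> i; [exact: pla | exact: xla].
Qed.

Lemma unshift_stable x : shift_space x -> shift_space (unshift x).
Proof.
apply: closure_stable; first exact: (@reindex_continuous int int).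
move=> {}x [la [pla xla]]; exists (fun i => la (i - 1)).
by split=> i; [rewrite pla subrK addrK | exact: xla].
Qed.

Definition tau (x : shift_space) : shift_space :=
  SigSub (mem_set (shift_stable (set_valP x))).
Definition tau_inv (x : shift_space) : shift_space :=
  SigSub (mem_set (unshift_stable (set_valP x))).

Lemma tau_continuous : continuous tau.
Proof.
apply: continuous_comp_initial => x.
apply: (@continuous_comp _ _ _ (set_val : shift_space -> biseq) shift).
  exact: (@initial_continuous _ _ (set_val : shift_space -> biseq)).
exact: (@reindex_continuous int int).
Qed.

Lemma tau_inv_continuous : continuous tau_inv.
Proof.
apply: continuous_comp_initial => x.
apply: (@continuous_comp _ _ _ (set_val : shift_space -> biseq) unshift).
  exact: (@initial_continuous _ _ (set_val : shift_space -> biseq)).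
exact: (@reindex_continuous int int).
Qed.

Lemma tauK : cancel tau tau_inv.
Proof. by move=> x; apply/val_inj; exact: shiftK. Qed.

Lemma tau_invK : cancel tau_inv tau.
Proof. by move=> x; apply/val_inj; exact: unshiftK. Qed.

Definition shift_homeo : homeomorphism shift_space :=
  @Homeomorphism shift_space (mkcts tau_continuous) (mkcts tau_inv_continuous)
    tauK tau_invK.

End ShiftSpace.

Arguments shift_homeo {A} E.

(* Main.v *)
Require Import Defs.
From HB Require Import structures.
From mathcomp Require Import all_boot all_order all_algebra.
From mathcomp Require Import all_classical all_reals all_analysis.
From mathcomp Require Import complex zify.

Set Implicit Arguments.
Unset Strict Implicit.
Unset Printing Implicit Defensive.

Import Order.TTheory GRing.Theory Num.Theory.
Import numFieldNormedType.Exports.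

Local Open Scope classical_set_scope.
Local Open Scope ring_scope.

(** Injectivity of [d] forces distinct letters to have disjoint ranges: a vertex
    in two of them gives two edges of the topological graph with the same image,
    the ultrafilter of the sets that contain the vertex.  Together with weak
    left-resolution this makes the ranges of distinct words of equal length
    disjoint ([rword_unique]), and as there are no sources these ranges cover
    the vertices.  Hence every vertex has exactly one labeled past, each set [U]
    of the Boolean algebra is decided by a finite piece of the past
    ([acc_determined]), and [U] corresponds to a clopen set of the shift space,
    the [cylinder] of the points whose past leads into [U].

    On this dictionary rest two representations.  In the crossed product the
    functions [pi 1_(cylinder U)] and the elements [u^* pi 1_[x_0 = a]] satisfy
    the relations of the labeled graph ([crossed_product_rep]).  In the labeled
    graph algebra [v = \sum_a s_a^*] is a unitary, and the elements
    [v^*^n p_(r al) v^n], with [al] of length [2n + 1], are projections that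
    multiply and add like the indicators of [x_(-n) ... x_n = al]; they extend
    to a representation of the continuous functions, covariant with [v]
    ([graph_covariant_rep]).  The two universal properties turn these into
    homomorphisms in both directions.  They are mutually inverse because they
    are so on generators: [s_a] and the windows [x_(-n) ... x_n = al] suffice,
    since [p_U] is obtained from the [s_a] by algebraic operations
    ([rep_generated]).

    The analysis needed is elementary and rests on one remark
    ([half_unitary_norm]): if [x] and [y] are self-adjoint, commute and
    [x^2 + y^2] is a projection, then [x] is the real part of the partial
    isometry [x + iy], so its norm is at most 1.  With [y] a square root of
    [1 - x^2] it shows that homomorphisms are contractive ([star_hom_norm],
    [Cfun_star_hom_norm]), so that agreement on generators is enough, and that a
    combination of orthogonal projections is bounded by its coefficients
    ([ortho_sum_norm]), so that the Riemann sums which define the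
    representation of the continuous functions converge ([cell_rep_exists]). *)

(** * Algebra and norm in C*-algebras *)

Section StarAlgebras.
Variables (R : realType) (V : starAlgType R).
Implicit Types x y z : V.

Lemma smul0l x : 0 ** x = 0.
Proof. by apply: (addrI (0 ** x)); rewrite -smulDl !addr0. Qed.

Lemma smul0r x : x ** 0 = 0.
Proof. by apply: (addrI (x ** 0)); rewrite -smulDr !addr0. Qed.

Lemma smulNl x y : (- x) ** y = - (x ** y).
Proof. by apply/eqP; rewrite -addr_eq0 -smulDl addNr smul0l. Qed.

Lemma smulNr x y : x ** (- y) = - (x ** y).
Proof. by apply/eqP; rewrite -addr_eq0 -smulDr addNr smul0r. Qed.

Lemma smulBl x y z : (x - y) ** z = x ** z - y ** z.
Proof. by rewrite smulDl smulNl. Qed.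

Lemma smulBr x y z : x ** (y - z) = x ** y - x ** z.
Proof. by rewrite smulDr smulNr. Qed.

Lemma star0 : star (0 : V) = 0.
Proof. by apply: (addrI (star 0)); rewrite -starD !addr0. Qed.

Lemma starN x : star (- x) = - star x.
Proof. by apply/eqP; rewrite -addr_eq0 -starD addNr star0. Qed.

Lemma starB x y : star (x - y) = star x - star y.
Proof. by rewrite starD starN. Qed.

Lemma smul_suml (I : Type) (r : seq I) (P : pred I) (F : I -> V) y :
  (\sum_(i <- r | P i) F i) ** y = \sum_(i <- r | P i) F i ** y.
Proof. exact: (big_morph (fun x => x ** y) (fun a b => smulDl a b y) (smul0l y)). Qed.

Lemma smul_sumr (I : Type) (r : seq I) (P : pred I) (F : I -> V) y :
  y ** (\sum_(i <- r | P i) F i) = \sum_(i <- r | P i) y ** F i.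
Proof. exact: (big_morph (smul y) (smulDr y) (smul0r y)). Qed.

Lemma star_sum (I : Type) (r : seq I) (P : pred I) (F : I -> V) :
  star (\sum_(i <- r | P i) F i) = \sum_(i <- r | P i) star (F i).
Proof. exact: (big_morph star (@starD _ _) star0). Qed.

Lemma is_identity_star (e : V) : is_identity e -> star e = e.
Proof.
move=> he; have := congr1 star (he (star e)).1.
by rewrite starM starK (he _).1.
Qed.

Lemma is_identity_projection (e : V) : is_identity e -> projection e.
Proof. by move=> he; split; [exact: is_identity_star | exact: (he _).1]. Qed.

End StarAlgebras.

Section StarHoms.
Variables (R : realType) (V W : starAlgType R) (phi : V -> W).
Hypothesis hphi : star_hom phi.

Lemma star_homD x y : phi (x + y) = phi x + phi y.
Proof. by have [l _ _] := hphi; have := l 1 x y; rewrite !scale1r. Qed.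

Lemma star_hom0 : phi 0 = 0.
Proof. by apply: (addrI (phi 0)); rewrite -star_homD !addr0. Qed.

Lemma star_homZ k x : phi (k *: x) = k *: phi x.
Proof. by have [l _ _] := hphi; have := l k x 0; rewrite star_hom0 !addr0. Qed.

Lemma star_homN x : phi (- x) = - phi x.
Proof. by rewrite -scaleN1r star_homZ scaleN1r. Qed.

Lemma star_homB x y : phi (x - y) = phi x - phi y.
Proof. by rewrite star_homD star_homN. Qed.

Lemma star_homM x y : phi (x ** y) = phi x ** phi y.
Proof. by have [] := hphi. Qed.

Lemma star_hom_star x : phi (star x) = star (phi x).
Proof. by have [] := hphi. Qed.

Lemma star_hom_sum (I : Type) (r : seq I) (P : pred I) (F : I -> V) :
  phi (\sum_(i <- r | P i) F i) = \sum_(i <- r | P i) phi (F i).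
Proof. exact: (big_morph phi star_homD star_hom0). Qed.

Lemma star_hom_projection x : projection x -> projection (phi x).
Proof. by case=> sx xx; split; rewrite -?star_hom_star -?star_homM ?sx ?xx. Qed.

End StarHoms.

Lemma star_hom_id (R : realType) (V : starAlgType R) : star_hom (@id V).
Proof. by []. Qed.

Lemma star_hom_comp (R : realType) (U V W : starAlgType R)
    (psi : V -> W) (phi : U -> V) :
  star_hom psi -> star_hom phi -> star_hom (psi \o phi).
Proof.
move=> hpsi hphi; split=> [k x y|x y|x] /=.
- by rewrite (star_homD hphi) (star_homZ hphi) (star_homD hpsi) (star_homZ hpsi).
- by rewrite (star_homM hphi) (star_homM hpsi).
- by rewrite (star_hom_star hphi) (star_hom_star hpsi).
Qed.

Section CStarNorm.
Variables (R : realType) (V : cstarAlgType R).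
Implicit Types x y z : V.

Lemma norm_star x : `|star x| = `|x|.
Proof.
have le1 y : `|y| <= `|star y|.
  have [->|y0] := eqVneq y 0; first by rewrite normr0.
  have y_gt0 : 0 < `|y| by rewrite normr_gt0.
  rewrite -(ler_pM2r y_gt0) -expr2 -cstar_norm.
  exact: smul_norm.
by apply/eqP; rewrite eq_le le1 andbT -{2}(starK x) le1.
Qed.

Lemma projection_norm x : projection x -> `|x| <= 1.
Proof.
move=> [sx xx]; have := cstar_norm x; rewrite sx xx.
have [->|x0 /eqP] := eqVneq x 0; first by rewrite normr0.
rewrite -{1}[`|x|]mulr1 expr2.
by rewrite (inj_eq (mulfI _)) ?normr_eq0// eq_sym => /eqP ->.
Qed.

(** The element [z = x + iy] satisfies [z^* z = e], so it has norm at most 1, and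
    [x] is the mean of [z] and [z^*]. *)
Lemma half_unitary_norm x y e : star x = x -> star y = y -> x ** y = y ** x ->
  projection e -> x ** x + y ** y = e -> `|x| <= 1.
Proof.
move=> sx sy xy pe xye.
pose z := x + 'i *: y.
have sz : star z = x - 'i *: y by rewrite starD starZ sx sy conjCi scaleNr.
have nz : `|z| <= 1.
  rewrite -(@expr_le1 _ 2)// -cstar_norm sz.
  rewrite smulDr !smulBl !smulZl !smulZr scalerA -expr2 sqrCi scaleN1r opprK.
  by rewrite xy addrA subrK xye projection_norm.
have -> : x = 2^-1 *: (z + star z).
  by rewrite sz addrACA subrr addr0 -mulr2n -(scaler_nat 2 x) scalerA mulVf ?scale1r.
rewrite normrZ ger0_norm ?invr_ge0// ler_pdivrMl// mulr1.
by apply: (le_trans (ler_normD _ _)); rewrite norm_star -[2]/(1 + 1) lerD.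
Qed.

End CStarNorm.

(** * Automatic continuity of star homomorphisms *)

Section NormedSpaces.
Variable K : numFieldType.

Lemma dist_continuous (V W : normedModType K) (f : V -> W) (C : K) :
  (forall x y, `|f x - f y| <= C * `|x - y|) -> continuous f.
Proof.
move=> hf x; apply/cvgrPdist_lt => e e0.
have C1 : 0 < `|C| + 1 by apply: ltr_wpDl.
near=> y; apply: le_lt_trans (hf _ _) _.
have [->|xy] := eqVneq x y; first by rewrite subrr normr0 mulr0.
have nxy : 0 < `|x - y| by rewrite normr_gt0 subr_eq0.
have C0 : 0 <= C.
  rewrite -(pmulr_lge0 _ nxy); apply: le_trans (hf x y) => //.
apply: (@le_lt_trans _ _ ((`|C| + 1) * `|x - y|)).
  by rewrite ler_pM2r// ger0_norm// lerDl.
rewrite -ltr_pdivlMl//; near: y.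
by apply: cvgr_dist_lt => //; rewrite mulr_gt0// invr_gt0.
Unshelve. all: by end_near. Qed.

Lemma closed_equalizer (V W : normedModType K) (f g : V -> W) :
  continuous f -> continuous g -> closed [set x | f x = g x].
Proof.
move=> cf cg.
have -> : [set x | f x = g x] = (fun x => f x - g x) @^-1` [set 0].
  apply/seteqP; split => x /=; first by move=> ->; rewrite subrr.
  by move/eqP; rewrite subr_eq0 => /eqP.
apply: closed_comp => [x _|]; first by apply: cvgB; [exact: cf | exact: cg].
exact/accessible_closed_set1/hausdorff_accessible/norm_hausdorff.
Qed.

Lemma cauchy_seq_cvg (V : completeNormedModType K) (u : nat -> V) :
  (forall e, 0 < e -> exists N, forall n m, (N <= n)%N -> (N <= m)%N ->
     `|u n - u m| < e) -> exists l : V, u n @[n --> \oo] --> l.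
Proof.
move=> hu; suff : cvg (u n @[n --> \oo]) by exists (lim (u n @[n --> \oo])).
apply/cauchy_cvgP/cauchyP => e e0.
have [N hN] := hu e e0; exists (u N); exists N => // n /= Nn.
by rewrite -ball_normE /=; exact: hN.
Qed.

End NormedSpaces.

(** The order of the complex numbers is only partial; on real parts the claim is
    the convergence of a geometric sequence. *)
Lemma complex_expr_lt (R : realType) (c e : R[i]) : 0 <= c -> c < 1 -> 0 < e ->
  exists N, forall n, (N <= n)%N -> c ^+ n < e.
Proof.
move=> c0 c1 e0; have := RRe_real (ger0_real c0); have := RRe_real (gtr0_real e0).
set a := complex.Re c; set b := complex.Re e => hb ha.
rewrite -ha lecR in c0; rewrite -ha ltcR in c1; rewrite -hb ltcR in e0.
have /cvgrPdist_lt/(_ _ e0)[N _ hN] := @cvg_geometric R 1 a ltac:(by rewrite ger0_norm).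
exists N => n /hN; rewrite /= sub0r normrN mul1r ger0_norm ?exprn_ge0//.
by rewrite -hb -ha -rmorphXn /= ltcR.
Qed.

Section CStarContinuity.
Variables (R : realType) (V : cstarAlgType R).

Lemma star_continuous : continuous (@star R V).
Proof.
by apply: (@dist_continuous _ _ _ _ 1) => x y; rewrite -starB norm_star mul1r.
Qed.

Lemma smul_continuousl (y : V) : continuous (fun x : V => x ** y).
Proof.
apply: (@dist_continuous _ _ _ _ `|y|) => x x'.
by rewrite -smulBl mulrC smul_norm.
Qed.

Lemma smul_continuousr (y : V) : continuous (fun x : V => y ** x).
Proof.
by apply: (@dist_continuous _ _ _ _ `|y|) => x x'; rewrite -smulBr smul_norm.
Qed.

Lemma cvg_smul (T : Type) (F : set_system T) (FF : Filter F) (f g : T -> V) a b :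
  f t @[t --> F] --> a -> g t @[t --> F] --> b -> f t ** g t @[t --> F] --> a ** b.
Proof.
move=> fa gb; apply/cvgrPdist_lt => e e0.
pose M := `|a| + `|b| + 1.
have M0 : 0 < M by rewrite ltr_wpDl// addr_ge0.
have eM : 0 < e / 2 / M by rewrite !divr_gt0.
near=> t.
have -> : a ** b - f t ** g t = a ** (b - g t) + (a - f t) ** g t.
  by rewrite smulBr smulBl addrA subrK.
have h1 : `|b - g t| < e / 2 / M by near: t; exact: cvgr_dist_lt.
have h2 : `|a - f t| < e / 2 / M by near: t; exact: cvgr_dist_lt.
have h3 : `|b - g t| < 1 by near: t; exact: cvgr_dist_lt.
have h4 : `|g t| <= M.
  rewrite -[g t](subKr b); apply: le_trans (ler_normB _ _) _.
  by rewrite /M -addrA ler_wpDl// lerD// ltW.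
rewrite [ltRHS]splitr; apply: le_lt_trans (ler_normD _ _) _.
apply: ler_ltD.
  apply: le_trans (smul_norm _ _) _; apply: (@le_trans _ _ (M * (e / 2 / M))).
    by apply: ler_pM => //; [rewrite /M -addrA lerDl addr_ge0 | exact: ltW].
  by rewrite mulrC divfK// gt_eqF.
apply: le_lt_trans (smul_norm _ _) _; apply: (@le_lt_trans _ _ (`|a - f t| * M)).
  by rewrite ler_wpM2l.
by rewrite -ltr_pdivlMr.
Unshelve. all: by end_near. Qed.

Lemma closed_star_subalgebra_eq (W : cstarAlgType R) (f g : V -> W) :
  continuous f -> continuous g -> star_hom f -> star_hom g ->
  closed_star_subalgebra [set x | f x = g x].
Proof.
move=> cf cg hf hg; split => /=.
- exact: closed_equalizer.
- by rewrite (star_hom0 hf) (star_hom0 hg).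
- move=> k x y ex ey.
  by rewrite (star_homD hf) (star_homD hg) (star_homZ hf) (star_homZ hg) ex ey.
- by move=> x y ex ey; rewrite (star_homM hf) (star_homM hg) ex ey.
- by move=> x ex; rewrite (star_hom_star hf) (star_hom_star hg) ex.
Qed.

(** The elements fixed by [e] on both sides form a closed star subalgebra. *)
Lemma identity_of_generates (G : set V) (e : V) : generates G ->
  star e = e -> (forall x, G x -> e ** x = x /\ x ** e = x) -> is_identity e.
Proof.
move=> hG se he x.
suff /seteqP[_ /(_ x)] : [set x | e ** x = x] `&` [set x | x ** e = x] = setT by apply.
apply: hG => //; split => /=.
- apply: closedI.
    by apply: closed_equalizer; [exact: smul_continuousr | move=> y; exact: cvg_id].
  by apply: closed_equalizer; [exact: smul_continuousl | move=> y; exact: cvg_id].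
- by rewrite smul0l smul0r.
- move=> k y z [y1 y2] [z1 z2].
  by rewrite smulDr smulDl smulZl smulZr y1 y2 z1 z2.
- by move=> y z [y1 y2] [z1 z2]; rewrite smulA y1 -smulA z2.
- move=> y [y1 y2]; split; apply: (can_inj (@starK _ _)).
    by rewrite starM se starK y2.
  by rewrite starM se starK y1.
Qed.

(** Writing [y = e - w], the equation [x^2 + y^2 = e] becomes
    [w = (x^2 + w^2) / 2].  The right-hand side maps the ball of radius
    [c = |x|^2 < 1] to itself, because [(c + c^2) / 2 <= c], and contracts it by
    the factor [c].  The iterates from [0] are self-adjoint and commute with
    [x], hence so does their limit. *)
Lemma selfadjoint_sqrt (e x : V) : is_identity e -> star x = x -> `|x| < 1 ->
  exists y, [/\ star y = y, x ** y = y ** x & x ** x + y ** y = e].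
Proof.
move=> he sx x1.
pose c := `|x| ^+ 2.
have c0 : 0 <= c by rewrite exprn_ge0.
have c1 : c < 1 by rewrite expr_lt1.
pose T w := 2^-1 *: (x ** x + w ** w) : V.
have Tc w : `|w| <= c -> `|T w| <= c.
  move=> wc; rewrite normrZ ger0_norm ?invr_ge0// ler_pdivrMl//.
  apply: le_trans (ler_normD _ _) _.
  rewrite mulr_natl mulr2n; apply: lerD.
    by apply: le_trans (smul_norm _ _) _; rewrite -expr2.
  apply: le_trans (smul_norm _ _) _; rewrite -[leRHS]mulr1.
  by apply: ler_pM => //; apply: le_trans wc (ltW c1).
have Tl w z : `|w| <= c -> `|z| <= c -> `|T w - T z| <= c * `|w - z|.
  move=> wc zc; rewrite -scalerBr normrZ ger0_norm ?invr_ge0// ler_pdivrMl//.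
  rewrite opprD addrACA subrr add0r.
  have -> : w ** w - z ** z = w ** (w - z) + (w - z) ** z.
    by rewrite smulBr smulBl addrA subrK.
  apply: le_trans (ler_normD _ _) _.
  rewrite mulr_natl mulr2n; apply: lerD; apply: le_trans (smul_norm _ _) _.
    by rewrite ler_wpM2r.
  by rewrite mulrC ler_wpM2r.
pose w n := iter n T 0.
have wc n : `|w n| <= c by elim: n => [|n ih]; rewrite ?normr0//= Tc.
have wd k n m : (k <= n)%N -> (k <= m)%N -> `|w n - w m| <= c ^+ k * 2.
  elim: k n m => [|k ih] n m kn km.
    rewrite expr0 mul1r; apply: le_trans (ler_normB _ _) _.
    by rewrite -[2]/(1 + 1); apply: lerD; apply: le_trans (wc _) (ltW c1).
  case: n m kn km => [|n] [|m] // kn km.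
  apply: le_trans (Tl _ _ (wc _) (wc _)) _.
  by rewrite exprS -mulrA ler_wpM2l// ih.
have [l wl] : exists l : V, w n @[n --> \oo] --> l.
  apply: cauchy_seq_cvg => d d0.
  have [N hN] := complex_expr_lt c0 c1 (divr_gt0 d0 (ltr0n _ 2)).
  exists N => n m Nn Nm; apply: le_lt_trans (wd N _ _ Nn Nm) _.
  by rewrite -ltr_pdivlMr// hN.
have swn n : star (w n) = w n.
  elim: n => [|n ih] /=; first by rewrite star0.
  by rewrite starZ starD !starM ih sx conj_Creal// ?rpredV ?realn.
have xwn n : x ** w n = w n ** x.
  elim: n => [|n ih] /=; first by rewrite smul0l smul0r.
  by rewrite smulZl smulZr smulDl smulDr !smulA ih -!smulA ih !smulA.
have clos (f g : V -> V) : continuous f -> continuous g ->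
    (forall n, f (w n) = g (w n)) -> f l = g l.
  move=> cf cg fg; apply: (@closed_cvg _ _ \oo _ w [set x | f x = g x]) wl.
    exact: closed_equalizer.
  by apply: nearW => n; exact: fg.
have sl : star l = l.
  by apply: (clos star id) => //; [exact: star_continuous | move=> y; exact: cvg_id].
have xl : x ** l = l ** x.
  apply: (clos (smul x) (fun z => z ** x)) => //; first exact: smul_continuousr.
  exact: smul_continuousl.
have Tll : T l = l.
  have h1 : T (w n) @[n --> \oo] --> T l.
    by apply: cvgZ; [exact: cvg_cst | apply: cvgD; [exact: cvg_cst | exact: cvg_smul]].
  have h2 : T (w n) @[n --> \oo] --> l.
    by move: wl; rewrite -(cvg_shiftS w).
  exact: (cvg_unique (@norm_hausdorff _ _) h1 h2).
exists (e - l); split.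
- by rewrite starB (is_identity_star he) sl.
- by rewrite smulBl smulBr xl (he x).1 (he x).2.
- have := congr1 ( *:%R 2) Tll; rewrite scalerA divff// scale1r => h.
  rewrite smulBl !smulBr (he e).1 (he l).1 (he l).2.
  have -> : x ** x = 2 *: l - l ** l by rewrite -h addrK.
  rewrite scaler_nat mulr2n opprB [e - l + _]addrACA -opprD.
  by rewrite [LHS]addrC addrA subrK addrK.
Qed.

End CStarContinuity.

Section AutomaticContinuity.
Variables (R : realType) (V W : cstarAlgType R) (e : V) (phi : V -> W).
Hypotheses (he : is_identity e) (hphi : star_hom phi).

(** For self-adjoint [y] with [|y| < 1], a square root of [e - y^2] exhibits
    [phi y] as the real part of an element of norm at most 1.  Rescaling and the
    C*-identity give the general case. *)
Lemma star_hom_norm x : `|phi x| <= `|x|.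
Proof.
have unit_ball y : star y = y -> `|y| < 1 -> `|phi y| <= 1.
  move=> sy y1; have [z [sz yz yze]] := selfadjoint_sqrt he sy y1.
  apply: (@half_unitary_norm _ _ _ (phi z) (phi e)).
  - by rewrite -(star_hom_star hphi) sy.
  - by rewrite -(star_hom_star hphi) sz.
  - by rewrite -!(star_homM hphi) yz.
  - exact/(star_hom_projection hphi)/is_identity_projection.
  - by rewrite -!(star_homM hphi) -(star_homD hphi) yze.
have selfadj y : star y = y -> `|phi y| <= `|y|.
  move=> sy; rewrite real_leNgt ?normr_real//; apply/negP => yphi.
  (* A number strictly between the two norms brings [y] into the open unit
     ball while the image stays outside the closed one. *)
  pose t := (`|y| + `|phi y|) / 2.
  have t_gt : `|y| < t by rewrite midf_lt.
  have t_lt : t < `|phi y| by rewrite midf_lt.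
  have t0 : 0 < t by apply: le_lt_trans t_gt.
  have nZ (U : cstarAlgType R) (z : U) : `|t^-1 *: z| = `|z| / t.
    by rewrite normrZ ger0_norm ?invr_ge0 ?ltW// mulrC.
  have : `|phi (t^-1 *: y)| <= 1.
    apply: unit_ball; last by rewrite nZ ltr_pdivrMr// mul1r.
    by rewrite starZ sy conj_Creal// realV gtr0_real.
  rewrite (star_homZ hphi) nZ ler_pdivrMr// mul1r => /(lt_le_trans t_lt).
  by rewrite ltxx.
rewrite -(@ler_pXn2r _ 2) ?nnegrE// -!cstar_norm.
by rewrite -(star_hom_star hphi) -(star_homM hphi) selfadj// starM starK.
Qed.

Lemma star_hom_continuous : continuous phi.
Proof.
apply: (@dist_continuous _ _ _ _ 1) => x y.
by rewrite -(star_homB hphi) mul1r star_hom_norm.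
Qed.

End AutomaticContinuity.

(** The equalizer is a closed star subalgebra since both maps are continuous. *)
Lemma star_hom_eq_generates (R : realType) (V W : cstarAlgType R) (G : set V)
    (e : V) (f g : V -> W) : is_identity e -> generates G ->
  star_hom f -> star_hom g -> (forall x, G x -> f x = g x) -> f =1 g.
Proof.
move=> he hG hf hg fg x.
suff /seteqP[_ /(_ x)] : [set x | f x = g x] = setT by apply.
apply: hG => //; apply: closed_star_subalgebra_eq => //.
  exact: star_hom_continuous he hf.
exact: star_hom_continuous he hg.
Qed.

(** * Orthogonal projections and continuous functions *)

Section OrthogonalProjections.
Variables (R : realType) (V : cstarAlgType R) (I : finType) (P : I -> V).
Hypothesis P_proj : forall i, projection (P i).
Hypothesis P_ortho : forall i j, i != j -> P i ** P j = 0.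

Lemma ortho_sumM (c d : I -> R[i]) :
  (\sum_i c i *: P i) ** (\sum_i d i *: P i) = \sum_i (c i * d i) *: P i.
Proof.
rewrite smul_suml; apply: eq_bigr => i _.
rewrite smul_sumr (bigD1 i)//= big1 => [|j ji].
  by rewrite addr0 smulZl smulZr scalerA (P_proj i).2.
by rewrite smulZl smulZr P_ortho ?scaler0// eq_sym.
Qed.

Lemma ortho_sum_star (c : I -> R[i]) :
  star (\sum_i c i *: P i) = \sum_i Num.conj (c i) *: P i.
Proof. by rewrite star_sum; apply: eq_bigr => i _; rewrite starZ (P_proj i).1. Qed.

(** With coefficients [a i] between 0 and 1 the sum is the real part of an
    element of norm at most 1, whose imaginary part has the coefficients
    [sqrt (1 - (a i)^2)]; the C*-identity reduces complex coefficients to their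
    squared moduli. *)
Lemma ortho_sum_norm (c : I -> R[i]) (M : R[i]) : 0 < M ->
  (forall i, P i != 0 -> `|c i| <= M) -> `|\sum_i c i *: P i| <= M.
Proof.
move=> M0 hc.
have real_case (a : I -> R[i]) : (forall i, 0 <= a i <= 1) ->
    `|\sum_i a i *: P i| <= 1.
  move=> ha; pose b i := sqrtC (1 - a i ^+ 2).
  have b2 i : 0 <= 1 - a i ^+ 2.
    by have /andP[a0 a1] := ha i; rewrite subr_ge0 expr_le1.
  have sa (d : I -> R[i]) : (forall i, 0 <= d i) ->
      star (\sum_i d i *: P i) = \sum_i d i *: P i.
    move=> d0; rewrite ortho_sum_star; apply: eq_bigr => i _.
    by rewrite conj_Creal// ger0_real.
  have a0 i : 0 <= a i by have /andP[] := ha i.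
  apply: (@half_unitary_norm _ _ _ (\sum_i b i *: P i) (\sum_i 1 *: P i)).
  - exact: sa.
  - by apply: sa => i; rewrite sqrtC_ge0.
  - by rewrite !ortho_sumM; apply: eq_bigr => i _; rewrite mulrC.
  - split; first exact: sa.
    by rewrite ortho_sumM; apply: eq_bigr => i _; rewrite mulr1.
  - rewrite !ortho_sumM -big_split; apply: eq_bigr => i _ /=.
    by rewrite -scalerDl -!expr2 sqrtCK addrC subrK.
pose c' i := if P i == 0 then 0 else c i / M.
have c'1 i : `|c' i| <= 1.
  rewrite /c'; case: ifPn => [|Pi]; first by rewrite normr0.
  by rewrite normrM normfV (gtr0_norm M0) ler_pdivrMr// mul1r hc.
have -> : \sum_i c i *: P i = M *: (\sum_i c' i *: P i).
  rewrite scaler_sumr; apply: eq_bigr => i _; rewrite /c' scalerA.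
  by case: eqP => [->|_]; rewrite ?scaler0// mulrC divfK// gt_eqF.
rewrite normrZ gtr0_norm// -[leRHS]mulr1 ler_pM2l//.
rewrite -(@expr_le1 _ 2)// -cstar_norm ortho_sum_star ortho_sumM.
by apply: real_case => i; rewrite mulrC -normCK exprn_ge0//= exprn_ile1.
Qed.

End OrthogonalProjections.

Section ContinuousFunctions.
Variables (R : realType) (X : topologicalType).
Implicit Types f g : Cfun R X.

Lemma CfunDE f g x : (f + g) x = f x + g x. Proof. by []. Qed.
Lemma CfunZE (k : R[i]) f x : (k *: f) x = k * f x. Proof. by []. Qed.
Lemma CfunME f g x : (f ** g) x = f x * g x. Proof. by []. Qed.
Lemma Cfun_starE f x : (star f) x = Num.conj (f x : R[i]). Proof. by []. Qed.

Lemma CfunBE f g x : (f - g) x = f x - g x. Proof. by []. Qed.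

Lemma Cfun_sumE (I : Type) (s : seq I) (Q : pred I) (F : I -> Cfun R X) x :
  (\sum_(i <- s | Q i) F i) x = \sum_(i <- s | Q i) F i x.
Proof. exact: (big_morph (fun f : Cfun R X => f x)). Qed.

(** From [|sqrt a - sqrt b|^2 <= |a - b|] for nonnegative [a] and [b]. *)
Lemma sqrtC_continuous (F : X -> R[i]^o) :
  continuous F -> (forall x, 0 <= F x) -> continuous (fun x => sqrtC (F x) : R[i]^o).
Proof.
move=> cF F0 x; apply/cvgrPdist_lt => e e0.
have e2 : 0 < e ^+ 2 by rewrite exprn_gt0.
have /cvgrPdist_lt/(_ _ e2) := cF x; apply: filterS => y xy.
have sx : 0 <= sqrtC (F x) by rewrite sqrtC_ge0.
have sy : 0 <= sqrtC (F y) by rewrite sqrtC_ge0.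
rewrite -(@ltr_pXn2r _ 2) ?nnegrE ?(ltW e0)//; apply: le_lt_trans xy.
have -> : F x - F y = (sqrtC (F x) - sqrtC (F y)) * (sqrtC (F x) + sqrtC (F y)).
  by rewrite -subr_sqr !sqrtCK.
rewrite normrM expr2 ler_wpM2l//.
apply: le_trans (ler_normB _ _) _.
by rewrite (ger0_norm sx) (ger0_norm sy) ger0_norm// addr_ge0.
Qed.

(** A function [g] with values between 0 and 1 has the continuous companion
    [sqrt (1 - g^2)], and the two combine to a unitary function. *)
Lemma Cfun_star_hom_norm (V : cstarAlgType R) (rho : Cfun R X -> V) (c : R[i]) f :
  star_hom rho -> 0 < c -> (forall x, `|f x| <= c) -> `|rho f| <= c.
Proof.
move=> hrho.
have unit_case g : (forall x, 0 <= g x <= 1) -> `|rho g| <= 1.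
  move=> hg; pose F x : R[i]^o := 1 - g x * g x.
  have F0 x : 0 <= F x.
    by have /andP[g0 g1] := hg x; rewrite subr_ge0 -expr2 expr_le1.
  have cF : continuous F.
    move=> x; apply: cvgB; first exact: cvg_cst.
    exact: Cfun_mul_continuous.
  pose h : Cfun R X := mkcts (sqrtC_continuous cF F0).
  have hE x : h x = sqrtC (F x) by [].
  have sg : star g = g.
    apply: Cfun_eqP => x; rewrite Cfun_starE conj_Creal// ger0_real//.
    by have /andP[] := hg x.
  have sh : star h = h.
    by apply: Cfun_eqP => x; rewrite Cfun_starE conj_Creal// ger0_real// hE sqrtC_ge0.
  apply: (@half_unitary_norm _ _ _ (rho h) (rho (Cfun1 R X))).
  - by rewrite -(star_hom_star hrho) sg.
  - by rewrite -(star_hom_star hrho) sh.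
  - by rewrite -!(star_homM hrho); congr rho; apply: Cfun_eqP => x; exact: mulrC.
  - apply: (star_hom_projection hrho); split; apply: Cfun_eqP => x.
      by rewrite Cfun_starE; exact: conjC1.
    exact: mulr1.
  - rewrite -!(star_homM hrho) -(star_homD hrho); congr rho; apply: Cfun_eqP => x.
    by rewrite CfunDE !CfunME hE -expr2 -expr2 sqrtCK /F expr2 addrC subrK.
move=> c0 hf; pose k : Cfun R X := c^-1 *: f.
have -> : f = c *: k by rewrite scalerA divff ?scale1r// gt_eqF.
rewrite (star_homZ hrho) normrZ gtr0_norm// -[leRHS]mulr1 ler_pM2l//.
rewrite -(@expr_le1 _ 2)// -cstar_norm -(star_hom_star hrho) -(star_homM hrho).
apply: unit_case => x; rewrite CfunME Cfun_starE mulrC -normCK exprn_ge0//=.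
rewrite exprn_ile1// CfunZE normrM normfV (gtr0_norm c0) mulrC.
by rewrite ler_pdivrMr// mul1r.
Qed.

Lemma indicator_continuous (K : set X) : open K -> open (~` K) ->
  continuous (fun x => (`[< K x >])%:R : R[i]^o).
Proof.
move=> oK oK' x; have [Kx|nKx] := pselect (K x).
  apply: (near_cst_continuous (1 : R[i]^o)); have : nbhs x K by exact: open_nbhs_nbhs.
  by apply: filterS => y Ky; rewrite (asboolT Ky).
apply: (near_cst_continuous (0 : R[i]^o)).
have : nbhs x (~` K) by exact: open_nbhs_nbhs.
by apply: filterS => y nKy; rewrite (asboolF nKy).
Qed.

(** Sealed behind its specification, as only the indicators of clopen sets carry
    a meaning; on other sets the function is arbitrary. *)
Lemma indicator_sig (K : set X) : {f : Cfun R X |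
  open K -> open (~` K) -> forall x, f x = (`[< K x >])%:R}.
Proof.
have [cK|nK] := pselect (continuous (fun x => (`[< K x >])%:R : R[i]^o)).
  by exists (mkcts cK).
by exists 0 => oK oK'; case: nK; exact: indicator_continuous.
Qed.

Definition indicator (K : set X) : Cfun R X := sval (indicator_sig K).

Lemma indicatorE (K : set X) x : open K -> open (~` K) ->
  indicator K x = (`[< K x >])%:R.
Proof. by move=> oK oK'; rewrite /indicator; case: indicator_sig => f /= ->. Qed.

End ContinuousFunctions.

(** * Representations of C(X) from refining partitions *)

(** A compact space with a sequence of finite clopen partitions, each refining
    the previous one, that together generate the topology. *)
Section RefiningPartitions.
Variables (R : realType) (X : topologicalType) (I : nat -> finType).
Variables (cell : forall n, X -> I n) (coarsen : forall n, I n.+1 -> I n).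
Hypothesis compactX : compact [set: X].
Hypothesis cell_coarsen : forall n x, coarsen (cell n.+1 x) = cell n x.
Hypothesis cell_open : forall n i, open (cell n @^-1` [set i]).
Hypothesis cell_basis : forall x U, nbhs x U ->
  exists n, forall y, cell n y = cell n x -> U y.

Lemma cell_le n m x y : (n <= m)%N -> cell m x = cell m y -> cell n x = cell n y.
Proof.
elim: m => [|m ih]; first by rewrite leqn0 => /eqP ->.
rewrite leq_eqVlt => /orP[/eqP ->//|nm] xy; apply: ih => //.
by rewrite -(cell_coarsen m x) -(cell_coarsen m y) xy.
Qed.

(** Uniform continuity, from compactness in its near-covering form. *)
Lemma cell_oscillation (f : Cfun R X) (e : R[i]) : 0 < e -> exists N, forall n,
  (N <= n)%N -> forall x y, cell n x = cell n y -> `|f x - f y| < e.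
Proof.
move=> e0; have e20 : 0 < e / 2 by rewrite divr_gt0.
have [] := (compact_near_coveringP [set: X]).1 compactX nat \oo
  (fun n x => forall y, cell n x = cell n y -> `|f x - f y| < e) _.
  move=> x _.
  have /cvgrPdist_lt/(_ _ e20)/cell_basis[N hN] := @cts_fun _ _ f x.
  have nx : nbhs x (cell N @^-1` [set cell N x]) by exact: open_nbhs_nbhs.
  exists (cell N @^-1` [set cell N x], [set n | (N <= n)%N]) => /=.
    by split => //; exists N.
  move=> [y n] /= [yx Nn] z yz.
  have zx : cell N z = cell N x by rewrite -yx; apply/esym/(cell_le Nn).
  rewrite [ltRHS]splitr; apply: le_lt_trans (ler_distD (f x) _ _) _.
  by rewrite ltrD//; [rewrite distrC; exact: hN | exact: hN].
by move=> N _ hN; exists N => n Nn x y; apply: (hN n).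
Qed.

Lemma cell_clopen n i : open (~` (cell n @^-1` [set i])).
Proof.
have -> : ~` (cell n @^-1` [set i]) =
    \bigcup_(j in [set j | j != i]) cell n @^-1` [set j].
  apply/seteqP; split => x /=; first by move=> /eqP xi; exists (cell n x).
  by move=> [j /= /eqP ji xj] xi; apply: ji; rewrite -xj.
by apply: bigcup_open => j _; exact: cell_open.
Qed.

Definition cell_indicator n i : Cfun R X := indicator R (cell n @^-1` [set i]).

Arguments cell_indicator n i : clear implicits.

Lemma cell_indicatorE n i x : cell_indicator n i x = (cell n x == i)%:R.
Proof.
rewrite indicatorE; [|exact: cell_open|exact: cell_clopen].
by congr (_%:R); congr nat_of_bool; apply/asboolP/eqP.
Qed.

Definition sample n (i : I n) : option X :=
  if pselect (exists x, cell n x = i) is left h then Some (projT1 (cid h)) else None.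

Lemma sampleP n x : exists2 y, sample (cell n x) = Some y & cell n y = cell n x.
Proof.
rewrite /sample; case: pselect => [h|[]]; last by exists x.
by case: cid => y /= hy; exists y.
Qed.

Lemma sampleS n (i : I n) x : sample i = Some x -> cell n x = i.
Proof. by rewrite /sample; case: pselect => // h [<-]; case: cid. Qed.

Definition sampled (g : X -> R[i]) n (i : I n) : R[i] :=
  if sample i is Some x then g x else 0.

Definition step (f : Cfun R X) n : Cfun R X :=
  \sum_i sampled f i *: cell_indicator n i.

Lemma stepE f n x y : sample (cell n x) = Some y -> step f n x = f y.
Proof.
move=> hy; rewrite Cfun_sumE (bigD1 (cell n x))//= big1 => [|j jx].
  by rewrite addr0 CfunZE cell_indicatorE eqxx mulr1 /sampled hy.
by rewrite CfunZE cell_indicatorE eq_sym (negPf jx) mulr0.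
Qed.

Section Uniqueness.
Variables (V : cstarAlgType R) (rho sigma : Cfun R X -> V).
Hypotheses (hrho : star_hom rho) (hsigma : star_hom sigma).

(** Step functions are uniformly dense and homomorphisms are contractive. *)
Lemma star_hom_eq_cells :
  (forall n i, rho (cell_indicator n i) = sigma (cell_indicator n i)) -> rho =1 sigma.
Proof.
move=> eq_cell f; apply/eqP; rewrite -subr_eq0 -normr_eq0; apply/negPn/negP => ne.
set d := `|rho f - sigma f| in ne.
have d0 : 0 < d by rewrite lt_neqAle eq_sym ne normr_ge0.
have d4 : 0 < d / 2 / 2 by rewrite !divr_gt0.
have [N hN] := cell_oscillation f d4.
have small (pi : Cfun R X -> V) : star_hom pi -> `|pi f - pi (step f N)| <= d / 2 / 2.
  move=> hpi; rewrite -(star_homB hpi); apply: Cfun_star_hom_norm => // x.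
  have [y sy yx] := sampleP N x.
  by rewrite CfunBE (stepE _ sy) ltW// (hN N).
have : d <= d / 2 / 2 + d / 2 / 2.
  rewrite {1}/d -[rho f - sigma f](subrKA (rho (step f N))).
  apply: le_trans (ler_normD _ _) _; apply: lerD; first exact: small.
  have -> : rho (step f N) = sigma (step f N).
    rewrite (star_hom_sum hrho) (star_hom_sum hsigma); apply: eq_bigr => i _.
    by rewrite (star_homZ hrho) (star_homZ hsigma) eq_cell.
  by rewrite distrC; exact: small.
by rewrite -splitr ler_pdivlMr// mulr_natr mulr2n gerDl (lt_geF d0).
Qed.

End Uniqueness.

Section Existence.
Variables (V : cstarAlgType R) (P : forall n, I n -> V) (e : V).
Hypothesis P_proj : forall n i, projection (@P n i).
Hypothesis P_ortho : forall n (i j : I n), i != j -> P i ** P j = 0.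
Hypothesis P_refine : forall n i, @P n i = \sum_(j | coarsen j == i) P j.
Hypothesis P_empty : forall n i, (forall x, cell n x <> i) -> @P n i = 0.
Hypothesis P_total : \sum_i @P 0 i = e.

Definition riemann n (g : X -> R[i]) : V := \sum_(i : I n) sampled g i *: P i.

Lemma sample_nonempty n (i : I n) : P i != 0 -> exists x, sample i = Some x.
Proof.
move=> Pi; have [[x xi]|nx] := pselect (exists x, cell n x = i).
  by have [y] := sampleP n x; rewrite xi; exists y.
by move/eqP: Pi => []; apply: P_empty => x xi; apply: nx; exists x.
Qed.

Lemma eq_riemann n (g h : forall i : I n, R[i]) :
  (forall i x, sample i = Some x -> g i = h i) ->
  \sum_i g i *: P i = \sum_i h i *: P i.
Proof.
move=> gh; apply: eq_bigr => i _.
have [->|/sample_nonempty[x ix]] := eqVneq (P i) 0; first by rewrite !scaler0.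
by rewrite (gh i x).
Qed.

(** A function constant on the cells of level [n] has the same Riemann sum at
    every finer level, since the projections add up under refinement. *)
Lemma riemann_refine n m g : (n <= m)%N ->
  (forall x y, cell n x = cell n y -> g x = g y) -> riemann m g = riemann n g.
Proof.
move=> nm gn; elim: m nm => [|m ih]; first by rewrite leqn0 => /eqP ->.
rewrite leq_eqVlt => /orP[/eqP ->//|nm]; rewrite -ih// /riemann.
transitivity (\sum_(j : I m.+1) sampled g (coarsen j) *: P j); last first.
  under [RHS]eq_bigr do rewrite P_refine scaler_sumr.
  rewrite (exchange_big_dep xpredT)//=; apply: eq_bigr => j _.
  by rewrite (big_pred1 (coarsen j))// => i; exact: eq_sym.
apply: eq_riemann => i x ix; have xi := sampleS ix.
have [y] := sampleP m x; rewrite -cell_coarsen xi /sampled ix => -> yx.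
by apply: gn; apply: (@cell_le n m); rewrite // yx -xi cell_coarsen.
Qed.

Lemma riemann_dist n (g h : X -> R[i]) (c : R[i]) : 0 < c ->
  (forall x, `|g x - h x| <= c) -> `|riemann n g - riemann n h| <= c.
Proof.
move=> c0 gh; rewrite /riemann -sumrB.
under eq_bigr do rewrite -scalerBl.
apply: ortho_sum_norm => // [|i Pi]; first exact: P_ortho.
by have [x ix] := sample_nonempty Pi; rewrite /sampled ix.
Qed.

(** At the finer level [m], the coarser sum is that of the function [g] that is
    constant on cells of level [n]; it differs from [f] by the oscillation. *)
Lemma riemann_cauchy (f : Cfun R X) (d : R[i]) : 0 < d ->
  exists N, forall n m, (N <= n)%N -> (N <= m)%N ->
    `|riemann n f - riemann m f| < d.
Proof.
move=> d0; have d3 : 0 < d / 3 by rewrite divr_gt0.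
have [N hN] := cell_oscillation f d3.
exists N => n m; wlog nm : n m / (n <= m)%N.
  move=> wl Nn Nm; case/orP: (leq_total n m) => [nm|mn]; first exact: wl.
  by rewrite distrC; exact: wl.
move=> Nn Nm.
pose g x : R[i] := sampled f (cell n x).
have gf x : `|g x - f x| <= d / 3.
  have [y sy yx] := sampleP n x.
  by rewrite /g /sampled sy ltW// (hN n).
have -> : riemann n f = riemann n g.
  apply: eq_riemann => i x ix; rewrite {2}/sampled ix /g.
  by rewrite (sampleS ix).
rewrite -(riemann_refine nm) => [|x y xy]; last by rewrite /g xy.
apply: le_lt_trans (riemann_dist _ d3 gf) _.
by rewrite ltr_pdivrMr// ltr_pMr// ltr1n.
Qed.

(** With the sample points fixed, each Riemann sum is already linear,
    multiplicative and compatible with adjoints in [f]; the limit inherits all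
    of this. *)
Lemma cell_rep_exists : exists pi : Cfun R X -> V,
  [/\ star_hom pi, pi (Cfun1 R X) = e
    & forall n i, pi (cell_indicator n i) = P i].
Proof.
have lim_ex (f : Cfun R X) : exists l : V, riemann n f @[n --> \oo] --> l.
  by apply: cauchy_seq_cvg => d; exact: riemann_cauchy.
have [pi hpi] := choice lim_ex; exists pi.
have lim_eq (f : Cfun R X) (l : V) : riemann n f @[n --> \oo] --> l -> pi f = l.
  exact: (cvg_unique (@norm_hausdorff _ _) (hpi f)).
split; first split.
- move=> k f g; apply: lim_eq.
  have -> : (fun n => riemann n (k *: f + g)) =
      (fun n => k *: riemann n f + riemann n g).
    apply/funext => n; rewrite /riemann scaler_sumr -big_split /=.
    apply: eq_bigr => i _; rewrite scalerA -scalerDl; congr (_ *: _).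
    by rewrite /sampled; case: sample => [x //|]; rewrite mulr0 addr0.
  by apply: cvgD => //; apply: cvgZ => //; exact: cvg_cst.
- move=> f g; apply: lim_eq.
  have -> : (fun n => riemann n (f ** g)) = (fun n => riemann n f ** riemann n g).
    apply/funext => n; rewrite /riemann ortho_sumM//; last exact: P_ortho.
    apply: eq_bigr => i _; congr (_ *: _).
    by rewrite /sampled; case: sample => [x //|]; rewrite mulr0.
  exact: cvg_smul.
- move=> f; apply: lim_eq.
  have -> : (fun n => riemann n (star f)) = (fun n => star (riemann n f)).
    apply/funext => n; rewrite /riemann ortho_sum_star//.
    apply: eq_bigr => i _; congr (_ *: _).
    by rewrite /sampled; case: sample => [x //|]; rewrite conjC0.
  by apply: (cvg_comp _ _ (hpi f)); exact: star_continuous.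
- apply: lim_eq; apply: cvg_near_cst; apply: nearW => n.
  rewrite (@riemann_refine 0 n)// -P_total /riemann.
  under [RHS]eq_bigr do rewrite -[P _]scale1r.
  by apply: eq_riemann => i x ix; rewrite /sampled ix.
- move=> m i; apply: lim_eq; apply: cvg_near_cst; exists m => // n /= mn.
  rewrite (@riemann_refine m n)//; last first.
    by move=> x y xy; rewrite !cell_indicatorE xy.
  have -> : P i = \sum_j (j == i)%:R *: P j.
    rewrite (bigD1 i)//= eqxx scale1r big1 ?addr0// => j /negPf ->.
    by rewrite scale0r.
  apply: eq_riemann => j x jx.
  by rewrite /sampled jx cell_indicatorE (sampleS jx).
Qed.

End Existence.

End RefiningPartitions.

(** * Ranges of words in a labeled graph *)

Section Words.
Variables (A : Type) (E : labeledGraph A).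
Implicit Types (U W : set (vertex E)) (al be : seq A).

Lemma rword_rrel al : rword E al = rrel setT al.
Proof.
apply/seteqP; split => v; first by move=> [e [q [pe le re]]]; exists e, q.
by move=> [e [q [pe _ le re]]]; exists e, q.
Qed.

Lemma rrel0 al : rrel set0 al = set0 :> set (vertex E).
Proof. by apply/seteqP; split => // v [e [q []]]. Qed.

Lemma rrel_sub U W al : U `<=` W -> rrel U al `<=` rrel W al.
Proof. by move=> UW v [e [q [pe /UW Ue le re]]]; exists e, q. Qed.

Lemma rrel_cons U a al : al <> [::] -> rrel U (a :: al) = rrel (rrel U [:: a]) al.
Proof.
move=> al0; apply/seteqP; split => v.
  move=> [e [[|f q] [/= pe Ue [le lq] re]]]; first by rewrite -lq in al0.
  exists f, q; split=> //; first by case: pe.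
  by exists e, [::]; split => //; [rewrite /= le | case: pe].
move=> [f [q [pf [e [q' [pe Ue le re]]] lf rf]]].
case: q' pe le re => [|? ?] // _ [le] re; exists e, (f :: q).
by split => //=; rewrite ?le -?lf.
Qed.

Lemma rrel_cat U al be : al <> [::] -> be <> [::] ->
  rrel U (al ++ be) = rrel (rrel U al) be.
Proof.
move=> + be0; elim: al U => // a [|b al] ih U _; first exact: rrel_cons.
by rewrite cat_cons rrel_cons// ih// [in RHS]rrel_cons.
Qed.

Lemma rrel_rcons U al a : al <> [::] -> rrel U (rcons al a) = rrel (rrel U al) [:: a].
Proof. by move=> al0; rewrite -cats1 rrel_cat. Qed.

Lemma rrel_sub_rword U al : rrel U al `<=` rword E al.
Proof. by rewrite rword_rrel; exact: rrel_sub. Qed.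

Lemma rword_suffix al be : be <> [::] -> rword E (al ++ be) `<=` rword E be.
Proof.
case: al => [|a al] be0 //; rewrite !rword_rrel (@rrel_cat _ (a :: al))//.
exact: rrel_sub.
Qed.

Lemma rrel_neq0_lwords U al v : rrel U al v -> lwords E al.
Proof. by move=> [e [q [pe _ le _]]]; exists e, q. Qed.

Lemma lwords_rword al : lwords E al -> exists v, rword E al v.
Proof. by move=> [e [q [pe le]]]; exists (erng (last e q)), e, q. Qed.

Lemma acc_set0 U : accommodating E U -> accommodating E set0.
Proof. by move=> aU; rewrite -(setDv U); exact: acc_setD. Qed.

(** A word that labels no path has empty range, which belongs to the Boolean
    algebra as the difference of the range of a letter with itself. *)
Lemma acc_rword_neq0 al : al <> [::] -> accommodating E (rword E al).
Proof.
case: al => // a al _; have [lal|nal] := pselect (lwords E (a :: al)).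
  exact: acc_rword.
have -> : rword E (a :: al) = set0.
  by apply/seteqP; split => // v; rewrite rword_rrel => /rrel_neq0_lwords.
have [e ea] := label_surj E a.
apply: (@acc_set0 (rword E [:: a])); apply: acc_rword.
by exists e, [::]; rewrite /= ea.
Qed.

Lemma acc_rrel_word U al : accommodating E U -> accommodating E (rrel U al).
Proof.
move=> aU; have [lal|nal] := pselect (lwords E al); first exact: acc_rrel.
have -> : rrel U al = set0 by apply/seteqP; split => // v /rrel_neq0_lwords.
exact: acc_set0 aU.
Qed.

Hypothesis hsources : no_sources E.

Lemma vertex_range (v : vertex E) : exists a, rword E [:: a] v.
Proof. by have [e ev] := hsources v; exists (label e), e, [::]. Qed.

Hypothesis hd : injective (@tg_d A E).

(** Maximality: a larger filter containing some [U] without [v] would also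
    contain its complement in [r(a)]. *)
Lemma point_ultra_filter (v : vertex E) a : rword E [:: a] v ->
  ultra_filter (@ideal_letter A E a) [set U | @ideal_letter A E a U /\ U v].
Proof.
move=> rv; have ra : accommodating E (rword E [:: a]) by exact: acc_rword_neq0.
split; first split.
- by move=> U [].
- by exists (rword E [:: a]); split => //; split.
- by case.
- move=> U W [[aU Ur] Uv] [[aW Wr] Wv]; split; last by split.
  by split; [exact: acc_setI | move=> w [/Ur]].
- by move=> U W [_ Uv] iW UW; split => //; exact: UW.
- move=> eta [esub _ e0 eI eS] sub; apply/seteqP; split => // U eU.
  have iU := esub _ eU; split => //; apply: contrapT => nUv; apply: e0.
  have : eta (rword E [:: a] `\` U).
    apply: sub; split; last by split.
    by split; [apply: acc_setD => //; exact: iU.1 | move=> w []].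
  by move=> /(eI _ _ eU); rewrite setDE setICA setICr setI0.
Qed.

(** The image under [d] of the ultrafilter at [v] in the ideal of [r(a)] is the
    ultrafilter at [v] of the whole Boolean algebra, which does not remember
    [a]. *)
Lemma range_letter_unique (v : vertex E) a b :
  rword E [:: a] v -> rword E [:: b] v -> a = b.
Proof.
move=> ra rb.
pose pt c (rc : rword E [:: c] v) : tg_edge E :=
  existT _ c (SigSub (mem_set (point_ultra_filter rc))).
have iotaE c (rc : rword E [:: c] v) :
    Defs.iota [set U | @ideal_letter A E c U /\ U v] =
    [set U | accommodating E U /\ U v].
  apply/seteqP; split => U.
    by move=> [aU [W [[_ Wv] WU]]]; split => //; exact: WU.
  move=> [aU Uv]; split => //; exists (U `&` rword E [:: c]).
  split; last by move=> ? [].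
  split => //; split; last by move=> ? [].
  by apply: acc_setI => //; exact: acc_rword_neq0.
have : pt a ra = pt b rb.
  by apply: hd; apply/val_inj; rewrite /= !iotaE.
by move=> /(congr1 (@projT1 _ _)).
Qed.

Hypothesis hwlr : weakly_left_resolving E.

Lemma rrel_disjoint U W al : accommodating E U -> accommodating E W ->
  U `&` W = set0 -> rrel U al `&` rrel W al = set0.
Proof.
move=> aU aW UW; have [lal|nal] := pselect (lwords E al).
  by rewrite hwlr// UW rrel0.
by apply/seteqP; split => // v [/rrel_neq0_lwords].
Qed.

(** The last letters agree because the ranges of letters are disjoint; weak
    left-resolution passes the disjointness of the ranges of the remaining
    words on to [al a] and [be a]. *)
Lemma rword_unique al be v : size al = size be ->
  rword E al v -> rword E be v -> al = be.
Proof.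
elim/last_ind: al be v => [|al a ih] be v; first by case: be.
elim/last_ind: be => [|be b _]; first by rewrite size_rcons.
rewrite !size_rcons => -[sz] ral rbe.
have ab : a = b.
  by apply: (@range_letter_unique v);
    [apply: (@rword_suffix al) | apply: (@rword_suffix be)]; rewrite ?cats1.
subst b; congr rcons.
have [al0|al0] := pselect (al = [::]).
  by move: sz; rewrite al0 /= => /esym/size0nil.
have be0 : be <> [::] by move=> be0; apply: al0; apply: size0nil; rewrite sz be0.
rewrite rword_rrel rrel_rcons// -rword_rrel in ral.
rewrite rword_rrel rrel_rcons// -rword_rrel in rbe.
apply: contrapT => albe.
suff : set0 v by [].
rewrite -(@rrel_disjoint (rword E al) (rword E be) [:: a]).
- by split.
- exact: acc_rword_neq0.
- exact: acc_rword_neq0.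
- by apply/seteqP; split => // w [/(ih _ _ sz)/[apply]].
Qed.

Lemma rword_disjoint al be : size al = size be -> al <> be ->
  rword E al `&` rword E be = set0.
Proof.
by move=> sz albe; apply/seteqP; split => // v [/(rword_unique sz)/[apply]].
Qed.

(** By induction on the construction of the set.  For [r(U, be)] a long word is
    split as [ga be'] with [be'] as long as [be]: either [be'] differs from [be]
    and the ranges are disjoint, or the alternative for [ga] is transported
    along [be].  The case of [r(be)] is similar. *)
Lemma acc_determined U : accommodating E U -> exists N, forall al,
  (N < size al)%N -> rword E al `<=` U \/ rword E al `&` U = set0.
Proof.
elim=> {U}.
- move=> be lbe; exists (size be) => al szal.
  have be0 : be <> [::] by case: lbe => e [q [_ <-]].
  have [ga [al' [-> sz]]] : exists ga al', al = ga ++ al' /\ size al' = size be.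
    exists (take (size al - size be) al), (drop (size al - size be) al).
    by rewrite cat_take_drop size_drop subKn// ltnW.
  have [->|albe] := pselect (al' = be).
    by left; apply: rword_suffix.
  right; rewrite -subset0 -(rword_disjoint sz albe); apply: setSI.
  by apply: rword_suffix => al0; apply: be0; apply: size0nil; rewrite -sz al0.
- move=> U W _ [N hN] _ [M hM]; exists (maxn N M) => al; rewrite gtn_max.
  case/andP => /hN hU /hM hW.
  case: hU => hU; first by left; exact: subset_trans hU _.
  case: hW => hW; first by left; exact: subset_trans hW _.
  by right; rewrite setIUr hU hW setU0.
- move=> U W _ [N hN] _ [M hM]; exists (maxn N M) => al; rewrite gtn_max.
  case/andP => /hN hU /hM hW.
  case: hU => hU; last by right; rewrite setIA hU set0I.
  case: hW => hW; last by right; rewrite setICA hW setI0.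
  by left => v rv; split; [exact: hU | exact: hW].
- move=> U W _ [N hN] _ [M hM]; exists (maxn N M) => al; rewrite gtn_max.
  case/andP => /hN hU /hM hW.
  case: hU => hU; last by right; rewrite setDE setIA hU set0I.
  case: hW => hW; first by right; apply/seteqP; split => // v [/hW Wv [_]].
  left => v rv; split; first exact: hU.
  by move=> Wv; suff : set0 v by []; rewrite -hW.
- move=> U be aU [N hN] lbe; exists (N + size be)%N => al szal.
  have be0 : be <> [::] by case: lbe => e [q [_ <-]].
  have [ga [al' [al_cat sz szga]]] : exists ga al',
      [/\ al = ga ++ al', size al' = size be & (N < size ga)%N].
    exists (take (size al - size be) al), (drop (size al - size be) al).
    have bal : (size be <= size al)%N by apply: leq_trans (ltnW szal); exact: leq_addl.
    rewrite cat_take_drop size_drop subKn//; split => //.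
    by rewrite size_takel ?leq_subr// ltn_subRL addnC.
  have al0 : al' <> [::] by move=> al0; apply: be0; apply: size0nil; rewrite -sz al0.
  have ga0 : ga <> [::] by case: ga szga {al_cat}.
  have [albe|albe] := pselect (al' = be); last first.
    right; rewrite -subset0 -(rword_disjoint sz albe) al_cat.
    by apply: setISS; [exact: rword_suffix | exact: rrel_sub_rword].
  rewrite al_cat albe rword_rrel rrel_cat// -rword_rrel.
  have [gaU|gaU] := hN _ szga; first by left; exact: rrel_sub.
  by right; apply: rrel_disjoint => //; exact: acc_rword_neq0.
Qed.

End Words.

(** * The topology of the shift space *)

Section Factors.
Variable A : Type.
Implicit Types (x : int -> A) (j : int) (n : nat).

Definition subword x j n : seq A := mkseq (fun i => x (j + i%:Z)) n.

Lemma size_subword x j n : size (subword x j n) = n.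
Proof. exact: size_mkseq. Qed.

Lemma subword1 x j : subword x j 1 = [:: x j].
Proof. by rewrite /subword /mkseq /= addr0. Qed.

Lemma subword_rcons x j n : subword x j n.+1 = rcons (subword x j n) (x (j + n%:Z)).
Proof. by rewrite /subword mkseqS. Qed.

Lemma subword_cons x j n : subword x j n.+1 = x j :: subword x (j + 1) n.
Proof.
rewrite /subword /mkseq /= addr0; congr cons.
rewrite (iotaDl 1 0) -map_comp; apply: eq_map => i /=.
by rewrite PoszD addrA.
Qed.

Lemma subword_shift x j n k : subword (fun i => x (i + k)) j n = subword x (j + k) n.
Proof. by apply: eq_map => i /=; rewrite addrAC. Qed.

Lemma eq_subword x y j n :
  (forall i, (i < n)%N -> x (j + i%:Z) = y (j + i%:Z)) -> subword x j n = subword y j n.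
Proof. by move=> xy; apply/eq_in_map => i; rewrite mem_iota => /andP[_]; exact: xy. Qed.

Lemma subword_inj x y j n i : subword x j n = subword y j n -> (i < n)%N ->
  x (j + i%:Z) = y (j + i%:Z).
Proof.
by move=> xy ni; move: (congr1 (fun s => nth (x j) s i) xy); rewrite !nth_mkseq.
Qed.

End Factors.

Section Windows.
Variable A : finType.
Implicit Types (x : int -> A) (n : nat).

(** The words [x_(-n) ... x_n], nested so that passing from [n] to [n + 1] adds
    one letter at each end: refinement is then a projection. *)
Fixpoint window n : finType := if n is m.+1 then (A * window m * A)%type else A.

Fixpoint window_at x n : window n :=
  if n is m.+1 then (x (- m.+1%:Z), window_at x m, x m.+1%:Z) else x 0.

Fixpoint window_word n : window n -> seq A :=
  if n is m.+1 then fun w => w.1.1 :: rcons (window_word w.1.2) w.2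
  else fun a => [:: a].

Definition window_core n (w : window n.+1) : window n := w.1.2.

Lemma size_window_word n (w : window n) : size (window_word w) = n.*2.+1.
Proof. by elim: n w => [|n ih] w //=; rewrite size_rcons ih doubleS. Qed.

Lemma window_word_inj n : injective (@window_word n).
Proof.
elim: n => [|n ih] w w' /=; first by case.
case: w w' => [[a w] b] [[a' w'] b'] /= [-> ] /rcons_inj[/ih -> ->] //.
Qed.

Lemma window_word_surj n (al : seq A) : size al = n.*2.+1 ->
  exists w : window n, window_word w = al.
Proof.
elim: n al => [|n ih] [|a al] //=; first by case: al => // _; exists a.
case/lastP: al => // al b; rewrite size_rcons doubleS => -[/ih[w <-]].
by exists (a, w, b).
Qed.

Lemma window_word_at n x : window_word (window_at x n) = subword x (- n%:Z) n.*2.+1.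
Proof.
elim: n => [|n ih] /=; first by rewrite subword1 oppr0.
rewrite doubleS subword_rcons subword_cons rcons_cons ih.
congr (_ :: rcons _ (x _)); last by lia.
by congr subword; lia.
Qed.

Lemma window_at_inj n x y (i : int) : window_at x n = window_at y n ->
  (`|i| <= n)%N -> x i = y i.
Proof.
move=> xy ni; have := congr1 (@window_word n) xy; rewrite !window_word_at.
have -> : i = - n%:Z + (absz (i + n%:Z))%:Z by lia.
by move=> /subword_inj; apply; lia.
Qed.

End Windows.

(** Without sinks and sources a finite path extends to a bi-infinite one, by
    choosing a next and a previous edge for every edge. *)
Lemma paths_extend (A : Type) (E : labeledGraph A) (hsinks : no_sinks E)
    (hsources : no_sources E) e q : @is_path A E e q ->
  exists la : int -> edge E, (forall i, erng (la i) = esrc (la (i + 1))) /\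
    forall i : nat, (i <= size q)%N -> la i%:Z = nth e (e :: q) i.
Proof.
have [next hnext] := choice (fun f => hsinks (erng f)).
have [prev hprev] := choice (fun f => hsources (esrc f)).
have forward : forall f p, is_path f p -> exists g : nat -> edge E,
    (forall i, erng (g i) = esrc (g i.+1)) /\
    forall i, (i <= size p)%N -> g i = nth e (f :: p) i.
  move=> f p; elim: p f => [|f' p ih] f.
    move=> _; exists (fun i => iter i next f); split => [i|[]//].
    by rewrite /= hnext.
  case=> ff' /ih[g [gE gn]]; exists (fun i => if i is k.+1 then g k else f).
  split=> [[|i]|[|i]] //=; last exact: gn.
  by rewrite gn.
move=> /forward[g [gE gn]].
exists (fun i => if i is Posz n then g n else iter (absz i) prev e); split; last first.
  by move=> i iq; rewrite gn.
case=> [n|[|n]].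
- by have -> : n%:Z + 1 = n.+1 by lia.
- have -> : Negz 0 + 1 = 0%N by lia.
  by rewrite /= hprev gn.
- have -> : Negz n.+1 + 1 = Negz n by lia.
  by rewrite [absz _]/= [absz (Negz n)]/= [iter n.+2 _ _]/= hprev.
Qed.

Section ShiftSpaces.
Variables (A : finType) (E : labeledGraph A).
Local Notation X := (shift_space E).

Definition letter (x : X) : int -> A := set_val x.

Lemma letter_tau x i : letter (tau x) i = letter x (i + 1).
Proof. by []. Qed.

Lemma letter_tau_inv x i : letter (tau_inv x) i = letter x (i - 1).
Proof. by []. Qed.

Lemma coord_open k a : open [set x : biseq A | x k = a].
Proof.
have -> : [set x : biseq A | x k = a] =
    (fun x : biseq A => x k) @^-1` [set a : discrete_topology A] by [].
apply: open_comp => [x _|]; last exact: discrete_open.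
exact: (@proj_continuous _ (fun _ : int => discrete_topology A) k x).
Qed.

Lemma letter_open k a : open [set x : X | letter x k = a].
Proof.
have -> : [set x : X | letter x k = a] =
    (set_val : X -> biseq A) @^-1` [set x : biseq A | x k = a] by [].
apply: open_comp => [x _|]; last exact: coord_open.
exact: (@initial_continuous _ _ (set_val : X -> biseq A)).
Qed.

Lemma subword_nbhs (x : biseq A) j n :
  nbhs x [set y : biseq A | subword y j n = subword x j n].
Proof.
elim: n => [|n ih]; first by apply: filterS filterT.
have : nbhs x [set y : biseq A | y (j + n%:Z) = x (j + n%:Z)].
  by apply: open_nbhs_nbhs; split => //; exact: coord_open.
by apply: filterS2 ih => y /= h1 h2; rewrite !subword_rcons h1 h2.
Qed.

(** A finite window of a point of the closure is also a window of the label of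
    some bi-infinite path. *)
Lemma shift_space_lwords (x : X) j n : lwords E (subword (letter x) j n.+1).
Proof.
have [y [[la [pla yla]] xy]] := set_valP x _ (subword_nbhs (set_val x) j n.+1).
rewrite -xy; exists (la j), (subword la (j + 1) n).
have path_subword k m : is_path (la k) (subword la (k + 1) m).
  elim: m k => // m ih k; rewrite subword_cons /=; split; first exact: pla.
  exact: ih.
split; first exact: path_subword.
rewrite subword_cons /= yla; congr cons.
by rewrite /subword /mkseq -map_comp; apply: eq_map => i /=; rewrite yla.
Qed.

Lemma lwords_shift_space (hsinks : no_sinks E) (hsources : no_sources E) al j :
  lwords E al -> exists x : X, subword (letter x) j (size al) = al.
Proof.
move=> [e [q [pq <-]]].
have [la [laE laq]] := paths_extend hsinks hsources pq.
pose y : biseq A := fun i => label (la (i - j)).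
have yX : shift_space E y.
  apply: subset_closure; exists (fun i => la (i - j)); split=> // i.
  by rewrite laE addrAC.
exists (SigSub (mem_set yX)); rewrite size_map.
apply: (@eq_from_nth _ (label e)); first by rewrite size_subword size_map.
move=> i; rewrite size_subword => iq.
rewrite nth_mkseq// (nth_map e)//.
have -> : letter (SigSub (mem_set yX)) = y by [].
by rewrite /y addrC addKr laq.
Qed.

Lemma shift_space_compact : compact [set: X].
Proof.
have cA : compact (shift_space E).
  apply: (@subclosed_compact _ _ setT) => //; first exact: closed_closure.
  have := @tychonoff int (fun _ => discrete_topology A) (fun _ => setT)
    (fun _ => @finite_compact (discrete_topology A) setT (@finite_finset A setT)).
  by congr compact; apply/seteqP; split.
move=> F FF _; have FX : (set_val @ F) (shift_space E).
  by apply: (@filterS _ F _ setT) => [x _|]; [exact: set_valP | exact: filterT].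
have [y [yX yF]] := cA (set_val @ F) (fmap_proper_filter _ FF) FX.
exists (SigSub (mem_set yX)); split => // U B FU.
rewrite nbhsE => -[C [[C' oC' <-] Cy] CB].
have [z [[x Ux <-] C'x]] : set_val @` U `&` C' !=set0.
  apply: yF; first by apply: (@filterS _ F _ U) => // x Ux; exists x.
  by apply: open_nbhs_nbhs; split.
by exists x; split => //; exact: CB.
Qed.

Definition window_of n (x : X) : window A n := window_at (letter x) n.

Lemma window_of_core n x : window_core (window_of n.+1 x) = window_of n x.
Proof. by []. Qed.

Lemma window_of_open n i : open (window_of n @^-1` [set i]).
Proof.
elim: n i => [|n ih] i; first exact: letter_open.
have -> : window_of n.+1 @^-1` [set i] =
    [set x | letter x (- n.+1%:Z) = i.1.1] `&` window_of n @^-1` [set i.1.2]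
    `&` [set x | letter x n.+1%:Z = i.2].
  apply/seteqP; split => x /=; first by move=> <-.
  by case: i => -[a w] b /= [[<- <-] <-].
by apply: openI; [apply: openI|]; [exact: letter_open| exact: ih| exact: letter_open].
Qed.

(** The filter of sets containing all points that share some window with [x]
    converges to [x] in each coordinate, hence in the product topology. *)
Lemma window_of_basis (x : X) U : nbhs x U ->
  exists n, forall y, window_of n y = window_of n x -> U y.
Proof.
rewrite nbhsE => -[C [[C' oC' <-] /= C'x] CU].
pose F : set_system (biseq A) := [set B | exists n, forall y : biseq A,
  window_at y n = window_at (letter x) n -> B y].
have FF : Filter F.
  split.
  - by exists 0%N.
  - move=> B B' [n hn] [m hm]; exists (maxn n m) => y hy.
    have le k : (k <= maxn n m)%N -> window_at y k = window_at (letter x) k.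
      move=> kl; apply: (@window_word_inj A k); rewrite !window_word_at.
      by apply: eq_subword => i ik; apply: (window_at_inj hy); lia.
    by split; [apply/hn/le; rewrite leq_maxl | apply/hm/le; rewrite leq_maxr].
  - by move=> B B' BB' [n hn]; exists n => y /hn /BB'.
have FX : F --> (set_val x : biseq A).
  apply/cvg_sup => i B; rewrite nbhsE => -[D [[D' oD' <-] Dx] DB].
  exists (absz i) => y hy; apply: DB => /=.
  by rewrite (window_at_inj hy).
have /FX[n hn] : nbhs (set_val x : biseq A) C' by exact: open_nbhs_nbhs.
by exists n => y hy; apply: CU; exact: hn.
Qed.

Lemma window_determined_open (K : set X) n :
  (forall x y, window_of n x = window_of n y -> K x -> K y) -> open K.
Proof.
move=> hK.
have -> : K = \bigcup_(i in window_of n @` K) (window_of n @^-1` [set i]).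
  apply/seteqP; split => [x Kx|x [_ [y Ky <-] xy]].
    by exists (window_of n x) => //; exists x.
  by apply: hK Ky; rewrite xy.
by apply: bigcup_open => i _; exact: window_of_open.
Qed.

Lemma window_determined_openC (K : set X) n :
  (forall x y, window_of n x = window_of n y -> K x -> K y) -> open (~` K).
Proof.
move=> hK; apply: (@window_determined_open _ n) => x y xy nKx Ky.
by apply: nKx; apply: hK Ky.
Qed.

Lemma window_word_of n (x : X) :
  window_word (window_of n x) = subword (letter x) (- n%:Z) n.*2.+1.
Proof. exact: window_word_at. Qed.

Variable R : realType.

Definition window_fun n (i : window A n) : Cfun R X :=
  cell_indicator R (@window_of) i.

Lemma window_funE n (i : window A n) x : window_fun i x = (window_of n x == i)%:R.
Proof. exact/cell_indicatorE/window_of_open. Qed.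

Lemma star_hom_eq_windows (V : cstarAlgType R) (f g : Cfun R X -> V) :
  star_hom f -> star_hom g ->
  (forall n (i : window A n), f (window_fun i) = g (window_fun i)) -> f =1 g.
Proof.
apply: (@star_hom_eq_cells R X (window A) window_of (@window_core A)).
- exact: shift_space_compact.
- exact: window_of_core.
- exact: window_of_open.
- exact: window_of_basis.
Qed.

Lemma letter_iter_tau n (x : X) k :
  letter (iter n (@tau A E) x) k = letter x (k + n%:Z).
Proof.
by elim: n k => [|n ih] k; rewrite /= ?addr0// letter_tau ih; congr letter; lia.
Qed.

End ShiftSpaces.

(** * The crossed product represents the labeled graph *)

Section VertexCylinders.
Variables (A : finType) (E : labeledGraph A).
Hypotheses (hwlr : weakly_left_resolving E) (hd : injective (@tg_d A E)).
Local Notation X := (shift_space E).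
Implicit Types (x : X) (U W : set (vertex E)).

Definition past x n : seq A := subword (letter x) (- n%:Z) n.+1.

(** The clopen set of the shift space that corresponds to [U]: for [U] in the
    Boolean algebra the range of a sufficiently long past is either contained in
    [U] or disjoint from it, and the condition says that it is contained. *)
Definition cylinder U : set X := [set x | exists n, rword E (past x n) `<=` U].

Lemma size_past x n : size (past x n) = n.+1.
Proof. exact: size_subword. Qed.

Lemma past_nil x n : past x n <> [::].
Proof. by move=> /(congr1 size); rewrite size_past. Qed.

Lemma past0 x : past x 0 = [:: letter x 0].
Proof. by rewrite /past subword1 oppr0. Qed.

Lemma pastS x n : past x n.+1 = letter x (- n.+1%:Z) :: past x n.
Proof. by rewrite /past subword_cons; congr (_ :: subword _ _ _); lia. Qed.

Lemma past_tau x n : past (tau x) n.+1 = rcons (past x n) (letter x 1).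
Proof.
rewrite /past -[letter (tau x)]/(fun i => letter x (i + 1)) subword_shift subword_rcons.
by congr (rcons (subword _ _ _) (letter x _)); lia.
Qed.

Lemma past_rword_le x n m : (n <= m)%N -> rword E (past x m) `<=` rword E (past x n).
Proof.
move=> nm; rewrite -(subnK nm); elim: (m - n)%N => [|k ih] //.
apply: subset_trans ih; rewrite addSn pastS -cat1s.
by apply: rword_suffix; exact: past_nil.
Qed.

Lemma past_rword_neq0 x n : exists v, rword E (past x n) v.
Proof. exact/lwords_rword/shift_space_lwords. Qed.

Lemma eq_past x y n : window_of n x = window_of n y -> past x n = past y n.
Proof. by move=> xy; apply: eq_subword => i ni; apply: (window_at_inj xy); lia. Qed.

Lemma cylinder_determined U : accommodating E U -> exists N, forall x n,
  (N <= n)%N -> (cylinder U x -> rword E (past x n) `<=` U) /\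
                (~ cylinder U x -> rword E (past x n) `&` U = set0).
Proof.
move=> /(acc_determined hd hwlr)[N hN]; exists N => x n Nn.
have sz : (N < size (past x n))%N by rewrite size_past.
have [nU|nU] := hN _ sz.
  by split => // -[]; exists n.
split=> // -[m mU].
have [v vmn] := past_rword_neq0 x (maxn m n).
suff : set0 v by [].
rewrite -nU; split; first by apply: past_rword_le vmn; rewrite leq_maxr.
by apply: mU; apply: past_rword_le vmn; rewrite leq_maxl.
Qed.

Lemma cylinder_window U : accommodating E U -> exists n, forall x y,
  window_of n x = window_of n y -> cylinder U x -> cylinder U y.
Proof.
move=> /cylinder_determined[n hn]; exists n => x y xy Ux; exists n.
by rewrite -(eq_past xy); exact: (hn x n _).1.
Qed.

Lemma cylinder_open U : accommodating E U -> open (cylinder U).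
Proof. by move=> /cylinder_window[n]; exact: window_determined_open. Qed.

Lemma cylinder_openC U : accommodating E U -> open (~` cylinder U).
Proof. by move=> /cylinder_window[n]; exact: window_determined_openC. Qed.

Lemma cylinder0 : cylinder set0 = set0.
Proof.
apply/seteqP; split => // x [n xn].
by have [v /xn] := past_rword_neq0 x n.
Qed.

Lemma cylinderI U W : cylinder (U `&` W) = cylinder U `&` cylinder W.
Proof.
apply/seteqP; split => x.
  by move=> [n xn]; split; exists n => v /xn[].
move=> [[n xn] [m xm]]; exists (maxn n m) => v vnm; split.
  by apply: xn; apply: past_rword_le vnm; rewrite leq_maxl.
by apply: xm; apply: past_rword_le vnm; rewrite leq_maxr.
Qed.

(** The range of a past may lie in the union and in neither of the two sets; that
    of a longer past then lies in one of them. *)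
Lemma cylinderU U W : accommodating E U ->
  cylinder (U `|` W) = cylinder U `|` cylinder W.
Proof.
move=> aU; apply/seteqP; split => x; last first.
  by move=> [|] [n xn]; exists n => v /xn; [left | right].
move=> [n xn]; have [N hN] := cylinder_determined aU.
have [xU|/(hN x (maxn N n) _).2-/(_ (leq_maxl _ _)) xU] := pselect (cylinder U x).
  by left.
right; exists (maxn N n) => v vn.
have [Uv|//] : (U `|` W) v by apply: xn; apply: past_rword_le vn; rewrite leq_maxr.
by suff : set0 v by []; rewrite -xU.
Qed.

Lemma cylinder_word al n : size al = n.+1 ->
  cylinder (rword E al) = [set x | past x n = al].
Proof.
move=> szal; apply/seteqP; split => x /=; last by move=> <-; exists n.
move=> [m xm]; have [v vnm] := past_rword_neq0 x (maxn m n).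
apply: (rword_unique hd hwlr (v := v)); first by rewrite size_past szal.
  by apply: past_rword_le vnm; rewrite leq_maxr.
by apply: xm; apply: past_rword_le vnm; rewrite leq_maxl.
Qed.

Lemma cylinder_letter a : cylinder (rword E [:: a]) = [set x | letter x 0 = a].
Proof.
rewrite (@cylinder_word _ 0)//; apply/seteqP.
by split => x /=; rewrite past0; [case | move=> ->].
Qed.

(** Reading the letter [x_1] turns a past of [x] into a past of [tau x].  For the
    direct implication, weak left-resolution ensures that a past disjoint from
    [U] becomes one disjoint from [r(U, x_1)]. *)
Lemma cylinder_tau U x : accommodating E U ->
  cylinder (rrel U [:: letter x 1]) (tau x) <-> cylinder U x.
Proof.
move=> aU.
have past_rrel n :
    rword E (past (tau x) n.+1) = rrel (rword E (past x n)) [:: letter x 1].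
  by rewrite past_tau rword_rrel rrel_rcons -?rword_rrel//; exact: past_nil.
split; last by move=> [n xn]; exists n.+1; rewrite past_rrel; exact: rrel_sub.
move=> [m xm]; apply: contrapT => nxU.
have [N hN] := cylinder_determined aU.
have [_ /(_ nxU) xU] := hN x (maxn N m) (leq_maxl _ _).
have [v vm] := past_rword_neq0 (tau x) (maxn N m).+1.
suff : set0 v by [].
rewrite -(@rrel_disjoint _ _ hwlr _ _ [:: letter x 1] _ aU xU).
  split; first by rewrite -past_rrel.
  by apply: xm; apply: past_rword_le vm; rewrite leqW// leq_maxr.
by apply: acc_rword_neq0; exact: past_nil.
Qed.

Variable R : realType.

Definition cylinder_fun U : Cfun R X := indicator R (cylinder U).

Lemma cylinder_funE U x : accommodating E U ->
  cylinder_fun U x = (`[< cylinder U x >])%:R.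
Proof.
by move=> aU; rewrite indicatorE//; [exact: cylinder_open | exact: cylinder_openC].
Qed.

End VertexCylinders.

Section CovariantRepresentations.
Variables (R : realType) (X : topologicalType) (h : homeomorphism X).
Variables (D : cstarAlgType R) (pi : Cfun R X -> D) (u : D).
Hypothesis hcov : covariant_rep h pi u.

Let hpi : star_hom pi. Proof. by case: hcov. Qed.

Lemma covariant_mul_staru x : u ** (star u ** x) = x.
Proof. by case: hcov => _ id1 [_ uu] _; rewrite smulA uu (id1 x).1. Qed.

Lemma covariant_mul_u x : star u ** (u ** x) = x.
Proof. by case: hcov => _ id1 [uu _] _; rewrite smulA uu (id1 x).1. Qed.

Lemma covariant_comm (f : Cfun R X) :
  pi f ** star u = star u ** pi (f \o homeo_inv h : Cfun R X).
Proof. by case: hcov => _ _ _ <-; rewrite -smulA covariant_mul_u. Qed.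

Lemma covariant_conj (f : Cfun R X) :
  star u ** pi f ** u = pi (f \o homeo_fun h : Cfun R X).
Proof.
have -> : pi f = pi ((f \o homeo_fun h : Cfun R X) \o homeo_inv h : Cfun R X).
  by congr pi; apply: Cfun_eqP => x /=; rewrite homeo_invK.
rewrite -covariant_comm -smulA.
by case: hcov => _ id1 [-> _] _; rewrite (id1 _).2.
Qed.

End CovariantRepresentations.

Section CrossedProductRepresentation.
Variables (R : realType) (A : finType) (E : labeledGraph A).
Hypotheses (hwlr : weakly_left_resolving E) (hd : injective (@tg_d A E)).
Local Notation X := (shift_space E).
Variables (D : cstarAlgType R) (pi : Cfun R X -> D) (u : D).
Hypothesis hcov : covariant_rep (shift_homeo E) pi u.

Local Notation chi U := (cylinder_fun R U).
Local Notation letter_fun a := (cylinder_fun R (rword E [:: a])).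

(** Conjugation by [u] moves sets by [tau], whereas [s_a] carries the points with
    [x_0 = a] to those with [x_1 = a], which is a move by the inverse of [tau];
    hence the adjoint. *)
Definition crossed_isometry a : D := star u ** pi (letter_fun a).

Let hpi : star_hom pi. Proof. by case: hcov. Qed.

Let chiE U x : accommodating E U -> chi U x = (`[< cylinder U x >])%:R.
Proof. exact: cylinder_funE. Qed.

Let letter_funE a x : letter_fun a x = (letter x 0 == a)%:R.
Proof.
rewrite chiE ?cylinder_letter//; last exact: acc_rword_neq0.
by congr (_%:R); congr nat_of_bool; apply/asboolP/eqP.
Qed.

Let chi_proj U : accommodating E U -> projection (chi U).
Proof.
move=> aU; split; apply: Cfun_eqP => x.
  by rewrite Cfun_starE chiE// conjC_nat.
by rewrite (CfunME (chi U)) chiE//; case: asboolP => _; rewrite ?mulr1 ?mulr0.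
Qed.

Let letter_proj a : projection (letter_fun a).
Proof. by apply: chi_proj; exact: acc_rword_neq0. Qed.

Let star_isometry a : star (crossed_isometry a) = pi (letter_fun a) ** u.
Proof.
by rewrite starM starK -(star_hom_star hpi) (letter_proj a).1.
Qed.

Let isometry_starM a b :
  star (crossed_isometry a) ** crossed_isometry b = pi (letter_fun a ** letter_fun b).
Proof.
by rewrite star_isometry -smulA (covariant_mul_staru hcov) (star_homM hpi).
Qed.

(** Each relation becomes a pointwise identity between indicators once the
    unitary has been moved aside by covariance. *)
Lemma crossed_product_rep :
  labeled_graph_rep (fun U => pi (cylinder_fun R U)) crossed_isometry.
Proof.
split.
- by move=> U aU; apply: (star_hom_projection hpi); exact: chi_proj.
- move=> a; rewrite /partial_isometry -smulA isometry_starM (letter_proj a).2.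
  by rewrite -smulA -(star_homM hpi) (letter_proj a).2.
- rewrite -(star_hom0 hpi); congr pi; apply: Cfun_eqP => x.
  rewrite /cylinder_fun cylinder0 indicatorE ?setC0; [|exact: open0|exact: openT].
  by rewrite asboolF.
- move=> U W aU aW; rewrite -(star_homM hpi); congr pi; apply: Cfun_eqP => x.
  rewrite (CfunME (chi U) (chi W)) !chiE//; last exact: acc_setI.
  by rewrite cylinderI asbool_and -natrM mulnb.
- move=> U W aU aW; rewrite -(star_homD hpi) -(star_homB hpi); congr pi.
  apply: Cfun_eqP => x; rewrite (CfunBE (chi U + chi W)) (CfunDE (chi U)).
  rewrite !chiE//; [|exact: acc_setI|exact: acc_setU].
  rewrite cylinderI cylinderU// asbool_and asbool_or.
  by case: `[< _ >]; case: `[< _ >]; rewrite /= ?addr0 ?addrK ?subr0 ?add0r ?subrr.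
- move=> U a aU; rewrite /crossed_isometry smulA (covariant_comm hcov) -!smulA.
  congr smul; rewrite -!(star_homM hpi); congr pi; apply: Cfun_eqP => x.
  rewrite (CfunME _ (letter_fun a)) (CfunME (letter_fun a)) letter_funE.
  rewrite [_ * (_ == _)%:R]mulrC.
  rewrite chiE//; last exact: acc_rrel_word.
  have -> : (chi U \o homeo_inv (shift_homeo E) : Cfun R X) x = chi U (tau_inv x) by [].
  rewrite chiE//; case: eqP => [xa|_]; last by rewrite !mul0r.
  congr (_ * _%:R); congr nat_of_bool; apply/asbool_equiv_eq.
  have -> : a = letter (tau_inv x) 1 by rewrite letter_tau_inv subrr xa.
  by apply: iff_sym; rewrite -{2}(tau_invK x); apply: cylinder_tau.
- by move=> a; rewrite isometry_starM (letter_proj a).2.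
- move=> a b ab; rewrite isometry_starM -(star_hom0 hpi); congr pi.
  apply: Cfun_eqP => x; rewrite (CfunME (letter_fun a)) !letter_funE.
  by case: eqP => [->|_]; [case: eqP => // _; rewrite mulr0|rewrite mul0r].
- move=> U aU.
  under eq_bigr => a _.
    rewrite star_isometry -!smulA [pi _ ** (pi _ ** u)]smulA -(star_homM hpi).
    rewrite [pi _ ** (pi _ ** u)]smulA -(star_homM hpi) smulA (covariant_conj hcov).
    over.
  rewrite -(star_hom_sum hpi); congr pi; apply: Cfun_eqP => x.
  rewrite chiE// Cfun_sumE.
  have termE a : (letter_fun a ** (cylinder_fun R (rrel U [:: a]) ** letter_fun a)
      \o homeo_fun (shift_homeo E) : Cfun R X) x =
      ((letter x 1 == a) && `[< cylinder U x >])%:R.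
    have -> (f : Cfun R X) :
        (f \o homeo_fun (shift_homeo E) : Cfun R X) x = f (tau x) by [].
    rewrite (CfunME (letter_fun a)) (CfunME _ (letter_fun a)) letter_funE.
    rewrite letter_tau add0r.
    rewrite chiE; last exact: acc_rrel_word.
    case: eqP => [<-|_]; last by rewrite mul0r.
    by rewrite mul1r mulr1 (asbool_equiv_eq (cylinder_tau hwlr hd x aU)).
  under eq_bigr do rewrite termE.
  have [xU|nxU] := pselect (cylinder U x); last first.
    rewrite asboolF// big1 // => a _; first by rewrite andbF.
  rewrite asboolT// (bigD1 (letter x 1))/=; last first.
    rewrite inE /=.
    have := (cylinder_tau hwlr hd x aU).2 xU.
    move=> [n xn]; have [v /xn [e [q [pe Ue le re]]]] := past_rword_neq0 (tau x) n.
    by exists e; split => //; case: le.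
  rewrite eqxx big1 ?addr0// => a /andP[_ ax].
  by rewrite eq_sym (negPf ax).
Qed.

End CrossedProductRepresentation.

(** * Identities in a representation of the labeled graph *)

Section GraphRepresentations.
Variables (R : realType) (A : finType) (E : labeledGraph A).
Variables (B : cstarAlgType R) (p : set (vertex E) -> B) (s : A -> B).
Hypothesis hrep : labeled_graph_rep p s.
Implicit Types (U W : set (vertex E)) (a b : A) (al : seq A).

Lemma rep_rrel U a : accommodating E U ->
  p (rrel U [:: a]) = star (s a) ** p U ** s a.
Proof.
move=> aU; rewrite -smulA (lgr_comm hrep)// smulA (lgr_starM hrep).
rewrite -(lgr_setI hrep); [|exact: acc_rword_neq0|exact: acc_rrel_word].
by congr p; apply/esym/setIidPr; exact: rrel_sub_rword.
Qed.

Lemma rep_setD U W : accommodating E U -> accommodating E W ->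
  p (U `\` W) = p U - p (U `&` W).
Proof.
move=> aU aW; have aD := acc_setD aU aW; have aI := acc_setI aU aW.
have := lgr_setU hrep aD aI.
rewrite setDE -setIUr setUC setUv setIT => ->.
have -> : U `&` ~` W `&` (U `&` W) = set0.
  by apply/seteqP; split => // v [[_ nW] [_]].
by rewrite (lgr_set0 hrep) subr0 addrK.
Qed.

(** The projections are words in the [s_a]: [p_(r(a)) = s_a^* s_a],
    [p_(r(U, a)) = s_a^* p_U s_a], and the Boolean operations are polynomial. *)
Lemma rep_generated (C : starAlgType R) (f g : B -> C) :
  star_hom f -> star_hom g -> (forall a, f (s a) = g (s a)) ->
  forall U, accommodating E U -> f (p U) = g (p U).
Proof.
move=> hf hg fg.
have step U a : accommodating E U -> f (p U) = g (p U) ->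
    f (p (rrel U [:: a])) = g (p (rrel U [:: a])).
  move=> aU fgU; rewrite rep_rrel// !(star_homM hf) !(star_homM hg).
  by rewrite (star_hom_star hf) (star_hom_star hg) fgU !fg.
have steps U al : al <> [::] -> accommodating E U -> f (p U) = g (p U) ->
    f (p (rrel U al)) = g (p (rrel U al)).
  elim: al U => // a [|b al] ih U _ aU fgU; first exact: step.
  by rewrite rrel_cons//; apply: ih => //; [exact: acc_rrel_word | exact: step].
have letters a : f (p (rword E [:: a])) = g (p (rword E [:: a])).
  rewrite -(lgr_starM hrep) !(star_homM hf) !(star_homM hg).
  by rewrite (star_hom_star hf) (star_hom_star hg) fg.
move=> U; elim=> {U}.
- move=> [|a [|b al]] lal; [by case: lal => e [q []] | exact: letters|].
  rewrite rword_rrel rrel_cons// -rword_rrel; apply: steps => //.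
  exact: acc_rword_neq0.
- move=> U W aU fU aW fW; rewrite (lgr_setU hrep)// (lgr_setI hrep)//.
  rewrite (star_homB hf) (star_homB hg) (star_homD hf) (star_homD hg).
  by rewrite (star_homM hf) (star_homM hg) fU fW.
- move=> U W aU fU aW fW; rewrite (lgr_setI hrep)//.
  by rewrite (star_homM hf) (star_homM hg) fU fW.
- move=> U W aU fU aW fW; rewrite rep_setD// (lgr_setI hrep)//.
  by rewrite (star_homB hf) (star_homB hg) (star_homM hf) (star_homM hg) fU fW.
- move=> U al aU fU lal; apply: steps => //.
  by case: lal => e [q [_ <-]].
Qed.

Lemma rep_disjoint_union (F : A -> set (vertex E)) :
  (forall b, accommodating E (F b)) -> accommodating E set0 ->
  (forall b c v, F b v -> F c v -> b = c) ->
  p [set v | exists b, F b v] = \sum_b p (F b).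
Proof.
move=> aF a0 dF.
have key (l : seq A) : uniq l ->
    accommodating E [set v | exists2 b, b \in l & F b v] /\
    p [set v | exists2 b, b \in l & F b v] = \sum_(b <- l) p (F b).
  elim: l => [|c l ih] /=.
    move=> _; have -> : [set v | exists2 b, b \in [::] & F b v] = set0.
      by apply/seteqP; split => // v [].
    by rewrite big_nil (lgr_set0 hrep).
  move=> /andP[cl /ih[al pl]].
  have -> : [set v | exists2 b, b \in c :: l & F b v] =
      F c `|` [set v | exists2 b, b \in l & F b v].
    apply/seteqP; split => v /=.
      by move=> [b]; rewrite inE => /orP[/eqP ->|bl] Fv; [left|right; exists b].
    by move=> [Fv|[b bl Fv]]; [exists c|exists b] => //; rewrite inE ?eqxx ?bl ?orbT.
  split; first exact: acc_setU.
  rewrite (lgr_setU hrep)// big_cons pl.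
  have -> : F c `&` [set v | exists2 b, b \in l & F b v] = set0.
    apply/seteqP; split => // v [Fc [b bl /(dF _ _ _ Fc) cb]].
    by rewrite cb bl in cl.
  by rewrite (lgr_set0 hrep) subr0.
have [_ <-] := key (index_enum A) (index_enum_uniq A).
congr p; apply/seteqP; split => v.
  by move=> [b Fv]; exists b => //; rewrite mem_index_enum.
by move=> [b _ Fv]; exists b.
Qed.

Hypotheses (hsources : no_sources E) (hwlr : weakly_left_resolving E).
Hypothesis hd : injective (@tg_d A E).

(** The identity, expected to be [p] of the set of all vertices; as a sum it
    makes sense even when there is no letter, and then no vertex. *)
Definition rep_unit : B := \sum_a p (rword E [:: a]).
Definition rep_unitary : B := \sum_a star (s a).
Local Notation e := rep_unit.
Local Notation v := rep_unitary.

Lemma rep_unit_pl U : accommodating E U -> e ** p U = p U.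
Proof.
move=> aU; rewrite smul_suml.
rewrite (eq_bigr (fun a => p (rword E [:: a] `&` U))); last first.
  by move=> a _; rewrite (lgr_setI hrep)//; exact: acc_rword_neq0.
rewrite -rep_disjoint_union.
- congr p; apply/seteqP; split => [w [b []]//|w Uw].
  by have [a ra] := vertex_range hsources w; exists a.
- by move=> b; apply: acc_setI => //; exact: acc_rword_neq0.
- exact: acc_set0 aU.
- by move=> b c w [rb _] [rc _]; exact: range_letter_unique rb rc.
Qed.

Lemma rep_unit_star : star e = e.
Proof.
rewrite star_sum; apply: eq_bigr => a _.
by rewrite (lgr_proj hrep _).1//; exact: acc_rword_neq0.
Qed.

Lemma rep_unit_pr U : accommodating E U -> p U ** e = p U.
Proof.
move=> aU; rewrite -[LHS]starK starM rep_unit_star (lgr_proj hrep aU).1.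
by rewrite rep_unit_pl// (lgr_proj hrep aU).1.
Qed.

(** The letter read before [al] is unique at each vertex of [r(al)]. *)
Lemma rep_extend_left al : al <> [::] ->
  p (rword E al) = \sum_b p (rword E (b :: al)).
Proof.
move=> al0; have aal := acc_rword_neq0 E al0; rewrite -rep_disjoint_union.
- congr p; apply/seteqP; split => w; last first.
    by move=> [b]; rewrite -cat1s; exact: rword_suffix.
  rewrite rword_rrel => -[f [q [pf _ lf rf]]].
  have [b rb] := vertex_range hsources (esrc f); exists b.
  by rewrite rword_rrel rrel_cons// -rword_rrel; exists f, q.
- by move=> b; exact: acc_rword_neq0.
- exact: acc_set0 aal.
- move=> b c w rb rc.
  by case: (rword_unique hd hwlr (erefl : size (b :: al) = size (c :: al)) rb rc).
Qed.

Lemma rep_s_range a : s a ** p (rword E [:: a]) = s a.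
Proof. by rewrite -(lgr_starM hrep) smulA; exact: (lgr_piso hrep). Qed.

Lemma rep_range_star a : p (rword E [:: a]) ** star (s a) = star (s a).
Proof.
rewrite -[in RHS](rep_s_range a) starM.
by rewrite (lgr_proj hrep _).1//; exact: acc_rword_neq0.
Qed.

Lemma rep_words_ortho al be : al <> [::] -> size al = size be -> al <> be ->
  p (rword E al) ** p (rword E be) = 0.
Proof.
move=> al0 sz albe.
have be0 : be <> [::] by move=> be0; apply/al0/size0nil; rewrite sz be0.
rewrite -(lgr_setI hrep); [|exact: acc_rword_neq0|exact: acc_rword_neq0].
by rewrite rword_disjoint// (lgr_set0 hrep).
Qed.

Lemma rep_mul_star a b : a <> b -> s a ** star (s b) = 0.
Proof.
move=> ab; rewrite -(rep_s_range a) -(rep_range_star b) smulA -[s a ** _ ** _]smulA.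
by rewrite rep_words_ortho// ?smul0r ?smul0l// => -[].
Qed.

Lemma rep_unit_s a : e ** s a = s a /\ s a ** e = s a.
Proof.
split.
  rewrite smul_suml.
  under eq_bigr => b _.
    rewrite (lgr_comm hrep); last exact: acc_rword_neq0.
    rewrite rword_rrel -rrel_cons// -rword_rrel.
    over.
  by rewrite -smul_sumr -rep_extend_left// rep_s_range.
rewrite -{1}(rep_s_range a) -smulA rep_unit_pr ?rep_s_range//.
exact: acc_rword_neq0.
Qed.

Lemma rep_unit_identity : generates (p @` accommodating E `|` range s) -> is_identity e.
Proof.
move=> hgen; apply: (identity_of_generates hgen rep_unit_star) => x.
case=> [[U aU <-]|[a _ <-]]; last exact: rep_unit_s.
by split; [exact: rep_unit_pl | exact: rep_unit_pr].
Qed.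

Lemma rep_unitaryE : star v = \sum_a s a.
Proof. by rewrite star_sum; apply: eq_bigr => a _; rewrite starK. Qed.

Lemma rep_unitary_mul_star : v ** star v = e.
Proof.
rewrite rep_unitaryE smul_suml; apply: eq_bigr => a _.
rewrite smul_sumr (bigD1 a)//= big1 ?addr0; first exact: (lgr_starM hrep).
by move=> b ba; apply: (lgr_ortho hrep) => ab; rewrite ab eqxx in ba.
Qed.

(** The cross terms [s_a s_b^*] vanish because the ranges of letters are
    disjoint, and [\sum_a s_a s_a^*] is the identity by the last relation applied
    to the range of each letter. *)
Lemma rep_unitary_star_mul : star v ** v = e.
Proof.
rewrite rep_unitaryE smul_suml.
transitivity (\sum_a s a ** star (s a)).
  apply: eq_bigr => a _; rewrite smul_sumr (bigD1 a)//= big1 ?addr0//.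
  by move=> b ba; apply: rep_mul_star => ab; rewrite ab eqxx in ba.
have sumE b : p (rword E [:: b]) = \sum_a s a ** p (rword E [:: b; a]) ** star (s a).
  rewrite (lgr_sum hrep); last exact: acc_rword_neq0.
  rewrite big_mkcond; apply: eq_bigr => a _.
  rewrite [rword E [:: b; a]]rword_rrel (@rrel_cons _ _ setT b [:: a])// -rword_rrel.
  case: ifPn => // /negP nout.
  have -> : rrel (rword E [:: b]) [:: a] = set0.
    apply/seteqP; split => // w [f [[|? ?] [_ rf lf _]]] //; apply: nout.
    by rewrite inE; exists f; split => //; case: lf.
  by rewrite (lgr_set0 hrep) smul0r smul0l.
rewrite /rep_unit (eq_bigr _ (fun b _ => sumE b)) exchange_big /=.
apply: eq_bigr => a _.
by rewrite -smul_suml -smul_sumr -rep_extend_left// rep_s_range.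
Qed.

(** The cross terms [s_a^* p_(r(al)) s_b] equal [s_a^* s_b p_(r(al b))] and
    vanish. *)
Lemma rep_extend_right al : al <> [::] ->
  v ** p (rword E al) ** star v = \sum_b p (rword E (rcons al b)).
Proof.
move=> al0; have aal := acc_rword_neq0 E al0.
rewrite rep_unitaryE smul_suml smul_suml; apply: eq_bigr => a _.
rewrite smul_sumr (bigD1 a)//= big1 ?addr0.
  by rewrite [rword E (rcons al a)]rword_rrel rrel_rcons// -rword_rrel rep_rrel.
move=> b ba; rewrite -smulA (lgr_comm hrep)// smulA (lgr_ortho hrep) ?smul0l//.
by move=> ab; rewrite ab eqxx in ba.
Qed.

End GraphRepresentations.

(** * The labeled graph algebra represents the dynamical system *)

Definition unitary_conj (R : realType) (V : starAlgType R) (v x : V) : V :=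
  star v ** x ** v.

Lemma unitary_conj_hom (R : realType) (V : starAlgType R) (e v : V) :
  is_identity e -> v ** star v = e -> star_hom (unitary_conj v).
Proof.
move=> he vv; split=> [k x y|x y|x]; rewrite /unitary_conj.
- by rewrite smulDr smulZr smulDl smulZl.
- by rewrite -!smulA [v ** (star v ** _)]smulA vv (he _).1.
- by rewrite !starM starK smulA.
Qed.

Lemma star_hom_iter (R : realType) (V : starAlgType R) (f : V -> V) n :
  star_hom f -> star_hom (iter n f).
Proof.
move=> hf; elim: n => [|n ih]; first exact: star_hom_id.
exact: (star_hom_comp hf ih).
Qed.

Lemma Cfun_comp_hom (R : realType) (X : topologicalType) (k : continuousType X X) :
  star_hom (fun f : Cfun R X => f \o k : Cfun R X).
Proof. by split => [c f g|f g|f]; apply: Cfun_eqP. Qed.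

Section GraphAlgebraRepresentation.
Variables (R : realType) (A : finType) (E : labeledGraph A).
Hypotheses (hsinks : no_sinks E) (hsources : no_sources E).
Hypotheses (hwlr : weakly_left_resolving E) (hd : injective (@tg_d A E)).
Variables (B : cstarAlgType R) (p : set (vertex E) -> B) (s : A -> B).
Hypothesis hrep : labeled_graph_rep p s.
Hypothesis hgen : generates (p @` accommodating E `|` range s).
Local Notation X := (shift_space E).

Let e : B := rep_unit p.
Let v : B := rep_unitary s.
Let he : is_identity e.
Proof. exact: (rep_unit_identity hrep hsources hwlr hd hgen). Qed.

Let conj_hom : star_hom (unitary_conj v).
Proof. exact: (unitary_conj_hom he (rep_unitary_mul_star hrep)). Qed.

Let conjn_hom n : star_hom (iter n (unitary_conj v)).
Proof. exact: star_hom_iter. Qed.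

(** The image of the indicator of the points in which [al] ends at the
    coordinate [n]. *)
Definition word_proj n al : B := iter n (unitary_conj v) (p (rword E al)).

Lemma word_proj_right n al : al <> [::] ->
  word_proj n al = \sum_b word_proj n.+1 (rcons al b).
Proof.
move=> al0; rewrite /word_proj.
under eq_bigr do rewrite iterSr.
rewrite -(star_hom_sum (conjn_hom n)) -(star_hom_sum conj_hom).
rewrite -(rep_extend_right hrep)// /unitary_conj !smulA.
rewrite (rep_unitary_star_mul hrep)//.
rewrite (he _).1 -smulA (rep_unitary_star_mul hrep)//.
by rewrite (he _).2.
Qed.

Lemma word_proj_left n al : al <> [::] ->
  word_proj n al = \sum_b word_proj n (b :: al).
Proof.
move=> al0; rewrite /word_proj -(star_hom_sum (conjn_hom n)).
by rewrite -(rep_extend_left hrep).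
Qed.

Definition window_proj n (w : window A n) : B := word_proj n (window_word w).

Let window_word_neq0 n (w : window A n) : window_word w <> [::].
Proof. by case: n w. Qed.

(** One letter is added on each side to refine level [n] into level [n + 1].  A
    word that is no window of the shift space labels no path, so its range is
    empty and its projection vanishes. *)
Lemma window_rep_exists : exists pi : Cfun R X -> B,
  [/\ star_hom pi, pi (Cfun1 R X) = e & forall n (i : window A n),
      pi (window_fun E R i) = window_proj i].
Proof.
apply: (@cell_rep_exists R X (window A) (@window_of A E) (@window_core A)).
- exact: shift_space_compact.
- exact: window_of_core.
- exact: window_of_open.
- exact: window_of_basis.
- move=> n i; apply: (star_hom_projection (conjn_hom n)).
  by apply: (lgr_proj hrep); exact: acc_rword_neq0.
- move=> n i j ij; rewrite -(star_homM (conjn_hom n)).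
  rewrite (rep_words_ortho hrep)// ?(star_hom0 (conjn_hom n))//.
    by rewrite !size_window_word.
  by move=> /window_word_inj ij'; rewrite ij' eqxx in ij.
- move=> n i; rewrite /window_proj word_proj_right//.
  have rcons_neq0 b : rcons (window_word i) b <> [::] by case: (window_word i).
  under eq_bigr => b _ do rewrite (word_proj_left _ (rcons_neq0 b)).
  rewrite exchange_big pair_bigA /=.
  rewrite (reindex_onto (fun ab : A * A => ((ab.1, i, ab.2) : window A n.+1))
    (fun j : window A n.+1 => (j.1.1, j.2))) /=.
    by apply: eq_big => [[a b]|[a b] _] /=; rewrite ?eqxx.
  by move=> [[a w] b] /= /eqP <-.
- move=> n i iX; rewrite /window_proj /word_proj.
  suff -> : rword E (window_word i) = set0.
    by rewrite (lgr_set0 hrep) (star_hom0 (conjn_hom n)).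
  apply/seteqP; split => // w; rewrite rword_rrel => /rrel_neq0_lwords.
  move=> /(lwords_shift_space hsinks hsources (- n%:Z))[x].
  rewrite size_window_word -window_word_of => /window_word_inj xi.
  exact: (iX x).
- by [].
Qed.

(** It suffices to compare [v^* (pi f) v] and [pi (f \o tau)] for the indicator
    [f] of a window [i] of level [n].  Both sides concern the word [i] ending at
    [n + 1]; it becomes a window of level [n + 1] after two letters are added on
    the left. *)
Lemma graph_covariant_rep : exists pi : Cfun R X -> B,
  covariant_rep (shift_homeo E) pi v /\ forall n (i : window A n),
    pi (window_fun E R i) = window_proj i.
Proof.
have [pi [hpi pi1 piw]] := window_rep_exists; exists pi; split => //.
have conj_tau : unitary_conj v \o pi =1
    pi \o (fun f : Cfun R X => f \o homeo_fun (shift_homeo E) : Cfun R X).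
  apply: star_hom_eq_windows; first exact: star_hom_comp.
    by apply: star_hom_comp => //; exact: Cfun_comp_hom.
  move=> n i; transitivity (word_proj n.+1 (window_word i)).
    by rewrite [LHS]/= piw.
  transitivity (\sum_ab word_proj n.+1 (ab.2 :: ab.1 :: window_word i)).
    rewrite word_proj_left//; under eq_bigr do rewrite word_proj_left//.
    by rewrite pair_bigA.
  have extension (ab : A * A) : exists w : window A n.+1,
      window_word w = ab.2 :: ab.1 :: window_word i.
    by apply: window_word_surj; rewrite /= size_window_word.
  have [J hJ] := choice extension.
  under eq_bigr => ab _ do rewrite -hJ -[word_proj _ _]/(window_proj (J ab)) -piw.
  rewrite -(star_hom_sum hpi); congr pi; apply: Cfun_eqP => x.
  rewrite -[RHS]/(window_fun E R i (tau x)) window_funE Cfun_sumE.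
  under eq_bigr => ab _ do rewrite window_funE -(inj_eq (@window_word_inj A n.+1)) hJ.
  rewrite -(inj_eq (@window_word_inj A n)) !window_word_of doubleS.
  rewrite -[letter (tau x)]/(fun k => letter x (k + 1)) subword_shift.
  rewrite !subword_cons.
  have -> : - n.+1%:Z + 1 = - n%:Z by lia.
  rewrite (bigD1 (letter x (- n%:Z), letter x (- n.+1%:Z)))//= big1 ?addr0.
    by rewrite !eqseq_cons !eqxx.
  move=> [a b] ab; rewrite !eqseq_cons /=.
  case: eqP => //= xb; case: eqP => //= xa.
  by rewrite xa xb eqxx in ab.
split => //.
- by rewrite pi1; exact: he.
- rewrite pi1; split; first exact: (rep_unitary_star_mul hrep).
  exact: (rep_unitary_mul_star hrep).
- move=> f.
  have -> : pi f = unitary_conj v (pi (f \o homeo_inv (shift_homeo E) : Cfun R X)).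
    apply: etrans (esym (conj_tau (f \o homeo_inv (shift_homeo E) : Cfun R X))).
    by congr pi; apply: Cfun_eqP => x; exact/esym/(congr1 f (tauK x)).
  rewrite /unitary_conj !smulA (rep_unitary_mul_star hrep) (he _).1.
  by rewrite -smulA (rep_unitary_mul_star hrep) (he _).2.
Qed.

End GraphAlgebraRepresentation.

(** * The isomorphism *)

Section Isomorphism.
Variables (R : realType) (A : finType) (E : labeledGraph A).
Hypotheses (hwlr : weakly_left_resolving E) (hd : injective (@tg_d A E)).
Local Notation X := (shift_space E).

Lemma cylinder_fun_letter a :
  cylinder_fun R (rword E [:: a]) = window_fun E R (a : window A 0).
Proof.
apply: Cfun_eqP => x; rewrite window_funE.
rewrite cylinder_funE ?cylinder_letter//; last exact: acc_rword_neq0.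
by congr (_%:R); congr nat_of_bool; apply/asboolP/eqP.
Qed.

Lemma sum_cylinder_fun_letter :
  \sum_a cylinder_fun R (rword E [:: a]) = Cfun1 R X.
Proof.
apply: Cfun_eqP => x; rewrite Cfun_sumE (bigD1 (letter x 0))//= big1.
  by rewrite addr0 cylinder_fun_letter window_funE eqxx.
by move=> b /negPf bx; rewrite cylinder_fun_letter window_funE eq_sym bx.
Qed.

(** The range of a word of length [2n + 1] prescribes the coordinates [-2n, ...,
    0]; shifting by [n] centers them. *)
Lemma cylinder_fun_shift n (i : window A n) :
  cylinder_fun R (rword E (window_word i)) \o iter n (@tau A E) =1 window_fun E R i.
Proof.
move=> x; rewrite /= window_funE cylinder_funE//; last first.
  by apply: acc_rword_neq0; case: n i.
rewrite (cylinder_word hwlr hd (size_window_word i)) /=.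
have -> : past (iter n (@tau A E) x) n.*2 = window_word (window_of n x).
  rewrite window_word_of; apply: eq_map => k.
  by rewrite letter_iter_tau; congr letter; lia.
congr (_%:R); congr nat_of_bool; apply/asboolP/eqP => [|->//].
exact: window_word_inj.
Qed.

Variables (B D : cstarAlgType R) (p : set (vertex E) -> B) (s : A -> B).
Variables (pi : Cfun R X -> D) (u : D) (phi : B -> D).
Hypotheses (hrep : labeled_graph_rep p s) (hcov : covariant_rep (shift_homeo E) pi u).
Hypotheses (hphi : star_hom phi).
Hypothesis phip : forall U, accommodating E U -> phi (p U) = pi (cylinder_fun R U).
Hypothesis phis : forall a, phi (s a) = crossed_isometry pi u a.

Let hpi : star_hom pi. Proof. by case: hcov. Qed.

(** The letters at the coordinate [0] partition the shift space. *)
Lemma universal_hom_unitary : phi (rep_unitary s) = u.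
Proof.
have [_ id1 _ _] := hcov.
rewrite -[RHS](id1 u).1 -sum_cylinder_fun_letter (star_hom_sum hphi).
rewrite (star_hom_sum hpi) smul_suml; apply: eq_bigr => a _.
rewrite (star_hom_star hphi) phis starM starK -(star_hom_star hpi).
congr (pi _ ** _); apply: Cfun_eqP => x; rewrite Cfun_starE.
by rewrite cylinder_funE ?conjC_nat//; exact: acc_rword_neq0.
Qed.

Lemma universal_hom_window n (i : window A n) :
  phi (window_proj p s i) = pi (window_fun E R i).
Proof.
rewrite /window_proj /word_proj.
have phi_conj m y : phi (iter m (unitary_conj (rep_unitary s)) y) =
    iter m (unitary_conj u) (phi y).
  elim: m => // m ih; rewrite !iterS -ih -universal_hom_unitary /unitary_conj.
  by rewrite !(star_homM hphi) (star_hom_star hphi).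
pose F (f : Cfun R X) : Cfun R X := f \o homeo_fun (shift_homeo E).
have pi_conj m g : iter m (unitary_conj u) (pi g) = pi (iter m F g).
  by elim: m => // m ih; rewrite iterS ih; exact: (covariant_conj hcov).
have FE m (g : Cfun R X) x : iter m F g x = g (iter m (@tau A E) x).
  by elim: m x => // m ih x; rewrite [in RHS]iterSr -ih.
rewrite phi_conj phip; last by apply: acc_rword_neq0; case: n i.
rewrite pi_conj; congr pi; apply: Cfun_eqP => x; rewrite FE.
exact: cylinder_fun_shift.
Qed.

End Isomorphism.

Theorem lemma4p17 (R : realType) (A : finType) (E : labeledGraph A)
    (hsinks : no_sinks E) (hsources : no_sources E)
    (hwlr : weakly_left_resolving E)
    (hd : injective (@tg_d A E))
    (B : cstarAlgType R) (p : set (vertex E) -> B) (s : A -> B)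
    (hB : is_labeled_graph_algebra p s)
    (D : cstarAlgType R) (pi : Cfun R (shift_space E) -> D) (u : D)
    (hD : is_crossed_product (shift_homeo E) pi u) :
  cstar_isomorphic B D.
Proof.
have [hrep genB univB] := hB.
have [hcov genD univD] := hD.
have [hpi id1 _ _] := hcov.
have [rho [hrho rhow]] := graph_covariant_rep hsinks hsources hwlr hd hrep genB.
have [hrho_hom _ _ _] := hrho.
have [phi [hphi phip phis]] := univB _ _ _ (crossed_product_rep hwlr hd hcov).
have [psi [hpsi psipi psiu]] := univD _ _ _ hrho.
exists phi; split=> //; exists psi.
- apply: (star_hom_eq_generates (rep_unit_identity hrep hsources hwlr hd genB) genB).
  + exact: star_hom_comp.
  + exact: star_hom_id.
  have psi_phi_s a : psi (phi (s a)) = s a.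
    rewrite phis (star_homM hpsi) (star_hom_star hpsi) psiu psipi.
    rewrite (cylinder_fun_letter R hwlr hd) rhow rep_unitaryE smul_suml.
    rewrite (bigD1 a)//= big1 ?addr0; first exact: (rep_s_range hrep).
    move=> b ba; rewrite -(rep_s_range hrep b) -smulA.
    rewrite (rep_words_ortho hrep) ?smul0r// => -[ab].
    by rewrite ab eqxx in ba.
  move=> x [[U aU <-]|[a _ <-]]; last exact: psi_phi_s.
  by apply: (rep_generated hrep (star_hom_comp hpsi hphi) (@star_hom_id R B)).
- apply: (star_hom_eq_generates id1 genD).
  + exact: star_hom_comp.
  + exact: star_hom_id.
  move=> x [[f _ <-]|->] /=; last first.
    by rewrite psiu (universal_hom_unitary hwlr hd hcov hphi phis).
  rewrite psipi; apply: (star_hom_eq_windows (star_hom_comp hphi hrho_hom) hpi) => n i.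
  by rewrite /= rhow (universal_hom_window hwlr hd hcov hphi phip phis).
Qed.
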